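(* Let $d,K,J\ge1$ be integers, let $\kappa_y,\kappa_\Psi,\kappa_h>0$ and $\ell_h\in[0,\infty)$, let $\Sigma\in\mathbb R^{d\times d}$, $\Gamma\in\mathbb R^{K\times K}$ be symmetric positive definite, and let $\mu_0$ be a Gaussian probability measure on $\mathbb R^d$. Let $\Psi_0\colon\mathbb R^d\to\mathbb R^d$ and $h_0\colon\mathbb R^d\to\mathbb R^K$ be constant functions. For $r>0$ let $B_{\Psi_0,h_0}(r)$ be the set of pairs $(\Psi,h)$ such that $\Psi\colon\mathbb R^d\to\mathbb R^d$ is Borel measurable with $\sup_u|\Psi(u)|\le\kappa_\Psi$ and $\sup_u|\Psi(u)-\Psi_0(u)|\le r$, and $h\colon\mathbb R^d\to\mathbb R^K$ is continuous with $\sup_u|h(u)|\le\kappa_h$, $\sup_u|h(u)-h_0(u)|\le r$, and Lipschitz constant at most $\ell_h$. Let $B_y$ be the set of $Y^\dagger=(y_1^\dagger,\dots,y_J^\dagger)\in\mathbb R^{KJ}$ with $\max_{1\le j\le J}|y_j^\dagger|\le\kappa_y$. For $Y^\dagger\in B_y$ and $(\Psi,h)\in B_{\Psi_0,h_0}(r)$ with some $r>0$, let $\mu_0^K=\mu_0$ and, for $j=0,\dots,J-1$, $$\mu_{j+1}=\mathsf B_j\mathsf Q\mathsf P\mu_j,\qquad \mu^K_{j+1}=\mathsf T_j\mathsf Q\mathsf P\mu^K_j .$$ Then for every $\epsilon>0$ there exists $\delta>0$ such that $$\sup_{Y^\dagger\in B_y}\ \sup_{(\Psi,h)\in B_{\Psi_0,h_0}(\delta)}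 d_g(\mu_J^K,\mu_J)\le\epsilon .$$
   Context: Notation: $|\cdot|$ is the Euclidean norm and, for $S$ symmetric positive definite, $|v|_S=|S^{-1/2}v|$. $\mathcal P^2(\mathbb R^n)$ is the set of Borel probability measures on $\mathbb R^n$ with finite second moment; $\mathcal C(\mu)$ is the covariance of $\mu$. For a probability measure $\pi$ on $\mathbb R^d\times\mathbb R^K$ (variables $(u,y)$), $\mathcal C^{uy}(\pi)\in\mathbb R^{d\times K}$ and $\mathcal C^{yy}(\pi)\in\mathbb R^{K\times K}$ denote the corresponding blocks of $\mathcal C(\pi)$. Measures and their Lebesgue densities are denoted by the same symbol. Weighted total variation metric: with $g(v)=1+|v|^2$ on $\mathbb R^n$, $d_g(\mu_1,\mu_2)=\sup_{|f|\le g}\left|\int f\,d\mu_1-\int f\,d\mu_2\right|$ for $\mu_1,\mu_2\in\mathcal P^2(\mathbb R^n)$, the supremum being over measurable $f\colon\mathbb R^n\to\mathbb R$ with $|f|\le g$ pointwise. Operators associated with $\Psi,h,\Sigma,\Gamma$ and the data: - $\mathsf P\mu(u)=\frac{1}{\sqrt{(2\pi)^d\det\Sigma}}\int_{\mathbb R^d}\exp\left(-\tfrac12|u-\Psi(v)|_\Sigma^2\right)\mu(dv)$ (the law of $\Psi(U)+\xi$ with $U\sim\mu$, $\xi\sim\mathcal N(0,\Sigma)$ independent). - $\mathsf Q\mu(u,y)=\frac{1}{\sqrt{(2\pi)^K\det\Gamma}}\exp\left(-\tfrac12|y-h(u)|_\Gamma^2\right)\mu(u)$ (the law on $\mathbb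 R^d\times\mathbb R^K$ of $(U,h(U)+\eta)$ with $U\sim\mu$, $\eta\sim\mathcal N(0,\Gamma)$ independent). - For $\pi$ on $\mathbb R^d\times\mathbb R^K$ with continuous Lebesgue density, $\mathsf B_j\pi(u)=\pi(u,y_{j+1}^\dagger)\big/\int_{\mathbb R^d}\pi(U,y_{j+1}^\dagger)\,dU$. - For $\pi\in\mathcal P^2(\mathbb R^d\times\mathbb R^K)$ with $\mathcal C^{yy}(\pi)$ positive definite, $\mathsf T_j\pi$ is the pushforward of $\pi$ under $(u,y)\mapsto u+\mathcal C^{uy}(\pi)\mathcal C^{yy}(\pi)^{-1}(y_{j+1}^\dagger-y)$. *)

(* Defs.v *)
From HB Require Import structures.
From mathcomp Require Import all_boot all_order all_algebra.
From mathcomp Require Import all_classical all_reals all_analysis.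
From mathcomp Require Import measurable_realfun.

Set Implicit Arguments.
Unset Strict Implicit.
Unset Printing Implicit Defensive.

Import Order.TTheory GRing.Theory Num.Theory.
Import numFieldNormedType.Exports.

Local Open Scope classical_set_scope.
Local Open Scope ring_scope.

(* R^n is 'cV[R]_n.  Its topology is the library's, that of the max norm;      *)
(* matrices get here the sigma-algebra generated by the open sets.            *)
Section borel_matrix.
Context (R : realType) (m n : nat).
Let G : set (set 'M[R]_(m, n)) := open.

HB.instance Definition _ := @isMeasurable.Build (sigma_display G) 'M[R]_(m, n)
  <<s G >> (@sigma_algebra0 _ setT G) (@sigma_algebraC _ G)
  (@sigma_algebra_bigcup _ setT G).

End borel_matrix.

Section borel_matrix_lemmas.
Context (R : realType) (m n : nat).

Lemma open_measurable_mx (U : set 'M[R]_(m, n)) : open U -> measurable U.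
Proof. exact: sub_sigma_algebra. Qed.

Lemma measurable_coord i j :
  measurable_fun setT (fun M : 'M[R]_(m, n) => M i j : R).
Proof.
apply: (measurability _ (RGenOpens.measurableE R)) => _ [_ [a [b ->]] <-].
rewrite setTI; apply: open_measurable_mx.
apply: open_comp; last exact: interval_open.
by move=> M _; exact: coord_continuous.
Qed.

Lemma measurable_fun_mx d (T : measurableType d) (f : T -> 'M[R]_(m, n)) :
  (forall i j, measurable_fun setT (fun x => f x i j : R)) ->
  measurable_fun setT f.
Proof.
move=> mf; apply: (measurability (open : set (set 'M[R]_(m, n))) erefl) => _ [U oU <-].
rewrite setTI.
pose box (p : 'M[rat]_(m, n) * nat) : set 'M[R]_(m, n) :=
  [set M | forall i j, ball (ratr (p.1 i j) : R) p.2.+1%:R^-1 (M i j)].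
pose F p : set T := if `[< box p `<=` U >] then f @^-1` box p else set0.
have -> : f @^-1` U = \bigcup_p F p.
  apply/seteqP; split=> [x Ux|x [p _]]; last first.
    by rewrite /F; case: asboolP => // sU; exact: sU.
  have /nbhs_ballP[e /= e0 sU] : nbhs (f x) U by exact: open_nbhs_nbhs.
  have [k ke] : exists k, k.+1%:R^-1 < e / 2.
    have e20 : 0 < (e / 2)^-1 by rewrite invr_gt0 divr_gt0.
    exists (Num.truncn (e / 2)^-1).
    by rewrite invf_plt ?posrE ?divr_gt0// truncnS_gt.
  have k0 : 0 < (k.+1%:R^-1 : R) by rewrite invr_gt0.
  have q_ i j : {q : rat | `|f x i j - ratr q| < k.+1%:R^-1}.
    apply: cid; have /rat_in_itvoo[q] :
      f x i j - k.+1%:R^-1 < f x i j + k.+1%:R^-1 by rewrite ltrBlDr -addrA ltrDl addr_gt0.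
    rewrite in_itv/= => qI; exists q.
    by rewrite distrC ltr_distl.
  exists (\matrix_(i, j) sval (q_ i j), k) => //.
  rewrite /F; case: asboolP => [_ i j/=|[]].
    by rewrite mxE /ball/= distrC; case: (q_ i j).
  move=> M /= bM; apply: sU; split => // i j.
  have := bM i j; rewrite mxE; case: (q_ i j) => q /= fq.
  rewrite /ball/= => Mq.
  rewrite (splitr e) (le_lt_trans (ler_distD (ratr q) _ _))// ltrD//.
    exact: lt_trans ke.
  exact: lt_trans ke.
apply: countable_bigcupT_measurable => [|p]; first exact: countableP.
rewrite /F; case: ifPn => // _.
rewrite (_ : _ @^-1` _ = \bigcap_(ij in [set: 'I_m * 'I_n])
    (fun x => f x ij.1 ij.2) @^-1` ball (ratr (p.1 ij.1 ij.2) : R) p.2.+1%:R^-1).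
  apply: fin_bigcap_measurable => // -[i j] _ /=; rewrite -[X in measurable X]setTI.
  apply: mf => //; exact: measurable_ball.
apply/seteqP; split=> x /= H; first by move=> [i j] _; exact: H.
by move=> i j; exact: (H (i, j)).
Qed.

End borel_matrix_lemmas.

Section transport_measure.
Context d1 d2 (T1 : measurableType d1) (T2 : measurableType d2) (R : realType).
Variable mu : {measure set T1 -> \bar R}.
Variables (f : T1 -> T2) (g : T2 -> T1).
Hypotheses (mf : measurable_fun setT f) (mg : measurable_fun setT g).
Hypotheses (fK : cancel f g) (mu_sigma_finite : sigma_finite setT mu).

(* pushforward by an isomorphism, so as to keep sigma-finiteness *)
Definition transport_measure & measurable_fun setT f & measurable_fun setT g
  & cancel f g & sigma_finite setT mu := pushforward mu f.

Let tmu := transport_measure mf mg fK mu_sigma_finite.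

Let tmu0 : tmu set0 = 0%E.
Proof. by rewrite /tmu /transport_measure /pushforward preimage_set0 measure0. Qed.

Let tmu_ge0 A : (0 <= tmu A)%E.
Proof. exact: measure_ge0. Qed.

Let tmu_sigma_additive : semi_sigma_additive tmu.
Proof.
move=> F mF tF mUF; rewrite /tmu /transport_measure /pushforward preimage_bigcup.
apply: measure_semi_sigma_additive.
- by move=> n; rewrite -[X in measurable X]setTI; exact: mf.
- apply/trivIsetP => /= i j _ _ ij; rewrite -preimage_setI.
  by move/trivIsetP : tF => /(_ _ _ _ _ ij) ->//; rewrite preimage_set0.
- by rewrite -preimage_bigcup -[X in measurable X]setTI; exact: mf.
Qed.

HB.instance Definition _ := isMeasure.Build _ _ _ tmu
  tmu0 tmu_ge0 tmu_sigma_additive.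

Let tmu_sigma_finite : sigma_finite setT tmu.
Proof.
have [F FT Ffin] := mu_sigma_finite.
exists (fun i => g @^-1` F i) => [|i].
  by rewrite -preimage_bigcup -FT preimage_setT.
have [mF Foo] := Ffin i; split.
  by rewrite -[X in measurable X]setTI; exact: mg.
rewrite /tmu /transport_measure /pushforward -comp_preimage.
by rewrite (_ : g \o f = id) //; apply/funext => x /=; rewrite fK.
Qed.

HB.instance Definition _ := Measure_isSigmaFinite.Build _ _ _ tmu
  tmu_sigma_finite.

End transport_measure.

Section lebesgue_measure_cV.
Context (R : realType).

Definition cv_cons n (p : measurableTypeR R * 'cV[R]_n) : 'cV[R]_n.+1 :=
  col_mx ((p.1 : R)%:M : 'M[R]_1) p.2.

Definition cv_uncons n (v : 'cV[R]_n.+1) : measurableTypeR R * 'cV[R]_n :=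
  (v ord0 ord0, dsubmx (v : 'cV[R]_(1 + n))).

Lemma cv_consK n : cancel (@cv_cons n) (@cv_uncons n).
Proof.
move=> [a v]; rewrite /cv_uncons /cv_cons col_mxKd; congr pair.
have E := col_mxEu (a%:M : 'M[R]_1) v ord0 ord0.
rewrite [RHS]mxE eqxx mulr1n in E; apply: etrans E.
by congr (col_mx _ _ _ _); exact: val_inj.
Qed.

Lemma measurable_cv_cons n : measurable_fun setT (@cv_cons n).
Proof.
apply: measurable_fun_mx => i j; rewrite ord1 /cv_cons.
case: (@split_ordP 1 n i) => k ->.
  apply: (eq_measurable_fun fst); last exact: measurable_fst.
  move=> x _; have E := col_mxEu ((x.1 : R)%:M : 'M[R]_1) x.2 k ord0.
  by rewrite (ord1 k) [RHS]mxE eqxx mulr1n in E *; rewrite E.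
apply: (eq_measurable_fun
  (fun x : measurableTypeR R * 'cV[R]_n => x.2 k ord0 : R)).
  move=> x _; exact: esym (col_mxEd ((x.1 : R)%:M : 'M[R]_1) x.2 k ord0).
exact: measurableT_comp (measurable_coord k ord0) measurable_snd.
Qed.

Lemma measurable_cv_uncons n : measurable_fun setT (@cv_uncons n).
Proof.
apply: measurable_fun_pair; first exact: measurable_coord.
apply: measurable_fun_mx => i j; under eq_fun do rewrite mxE.
exact: measurable_coord.
Qed.

Lemma sigma_finite_lebesgue_product n
    (m : {sigma_finite_measure set 'cV[R]_n -> \bar R}) :
  sigma_finite setT (@lebesgue_measure R \x m)%E.
Proof.
have /sigma_finiteP[F [TF ndF Foo]] := sigma_finiteT (@lebesgue_measure R).
have /sigma_finiteP[G [TG ndG Goo]] := sigma_finiteT m.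
exists (fun k => F k `*` G k) => [|k].
  rewrite -setXTT TF TG predeqE => -[x y]; split.
    move=> [/= [i _ Fix] [j _ Gjy]]; exists (maxn i j) => //; split.
    - by move: x Fix; exact/subsetPset/ndF/leq_maxl.
    - by move: y Gjy; exact/subsetPset/ndG/leq_maxr.
  by move=> [i _ []/= ? ?]; split; exists i.
have [? ?] := Foo k; have [? ?] := Goo k.
split; first exact: measurableX.
by rewrite product_measure1E// lte_mul_pinfty// ge0_fin_numE.
Qed.

(* R^n.+1 carries the product of the measures of R and R^n *)
Fixpoint leb n : {sigma_finite_measure set 'cV[R]_n -> \bar R} :=
  match n with
  | 0 => \d_(0 : 'cV[R]_0)
  | n'.+1 => transport_measure (@measurable_cv_cons n') (@measurable_cv_uncons n')
      (@cv_consK n') (@sigma_finite_lebesgue_product n' (leb n'))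
  end.

End lebesgue_measure_cV.

Section gaussian_filtering.
Context (R : realType).

Definition enorm n (v : 'cV[R]_n) : R := Num.sqrt (\sum_i v i ord0 ^+ 2).

Definition posdefmx n (S : 'M[R]_n) : Prop :=
  S^T = S /\ forall v : 'cV[R]_n, v != 0 -> 0 < (v^T *m S *m v) ord0 ord0.

(* the positive definite square root (unique when it exists, 0 otherwise) *)
Definition sqrtmx n (S : 'M[R]_n) : 'M[R]_n :=
  xget 0 [set B | posdefmx B /\ B *m B = S].

Definition wnorm n (S : 'M[R]_n) (v : 'cV[R]_n) : R :=
  enorm (sqrtmx (invmx S) *m v).

(* Every linear functional has a normal law; a Dirac mass counts as normal,   *)
(* so degenerate covariances are allowed.  The case s = 0 is separated        *)
(* because normal_prob m 0 is not the Dirac mass at m.                         *)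
Definition is_gaussian n (mu : set 'cV[R]_n -> \bar R) : Prop :=
  forall w : 'cV[R]_n, exists m s : R, forall A : set (measurableTypeR R),
    measurable A ->
    pushforward mu
      (fun v => (w^T *m v) ord0 ord0 : measurableTypeR R) A =
    if s == 0 then \d_(m : measurableTypeR R) A else normal_prob m s A.

Definition gauss_factor n (S : 'M[R]_n) : R :=
  (Num.sqrt ((2 * pi) ^+ n * \det S))^-1.

Definition density_measure d (T : measurableType d) (m : set T -> \bar R)
    (p : T -> R) : set T -> \bar R :=
  fun A => (\int[m]_(x in A) (p x)%:E)%E.

Definition cov d (T : measurableType d) (m : set T -> \bar R) k l
    (X : T -> 'cV[R]_k) (Y : T -> 'cV[R]_l) : 'M[R]_(k, l) :=
  let E f := fine (\int[m]_z (f z)%:E)%E in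
  \matrix_(i, j) E (fun z => (X z i ord0 - E (fun t => X t i ord0)) *
                             (Y z j ord0 - E (fun t => Y t j ord0))).

Definition dg n (mu1 mu2 : set 'cV[R]_n -> \bar R) : \bar R :=
  ereal_sup [set `|\int[mu1]_v (f v)%:E - \int[mu2]_v (f v)%:E|%E |
    f in [set f : 'cV[R]_n -> R | measurable_fun setT f /\
                                  forall v, `|f v| <= 1 + enorm v ^+ 2]].

(* As for the library's pushforward and normal_prob, the measures below are   *)
(* plain set functions.                                                       *)
Section operators.
Variables (d K : nat).

(* P mu, Q mu and B nu enter through their Lebesgue densities, given by the   *)
(* formulas below.  For h continuous, QP_density is continuous, so that it is *)
(* the representative at which conditioning on y evaluates the joint law.     *)
Definition P_density (Sigma : 'M[R]_d) (Psi : 'cV[R]_d -> 'cV[R]_d)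
    (mu : set 'cV[R]_d -> \bar R) (u : 'cV[R]_d) : R :=
  gauss_factor Sigma *
  fine (\int[mu]_v (expR (- 2^-1 * wnorm Sigma (u - Psi v) ^+ 2))%:E)%E.

Definition Q_density (Gamma : 'M[R]_K) (h : 'cV[R]_d -> 'cV[R]_K)
    (p : 'cV[R]_d -> R) (z : 'cV[R]_d * 'cV[R]_K) : R :=
  gauss_factor Gamma * expR (- 2^-1 * wnorm Gamma (z.2 - h z.1) ^+ 2) * p z.1.

Definition B_density (y : 'cV[R]_K) (q : 'cV[R]_d * 'cV[R]_K -> R)
    (u : 'cV[R]_d) : R :=
  q (u, y) / fine (\int[leb R d]_U (q (U, y))%:E)%E.

Definition T_measure (y : 'cV[R]_K) (nu : set ('cV[R]_d * 'cV[R]_K) -> \bar R)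
    : set 'cV[R]_d -> \bar R :=
  pushforward nu (fun z =>
    z.1 + cov nu fst snd *m invmx (cov nu snd snd) *m (y - z.2)).

Variables (Sigma : 'M[R]_d) (Gamma : 'M[R]_K).
Variables (Psi : 'cV[R]_d -> 'cV[R]_d) (h : 'cV[R]_d -> 'cV[R]_K).

Definition QP_density (mu : set 'cV[R]_d -> \bar R) :
    'cV[R]_d * 'cV[R]_K -> R :=
  Q_density Gamma h (P_density Sigma Psi mu).

Definition true_step (mu : set 'cV[R]_d -> \bar R) (y : 'cV[R]_K) :
    set 'cV[R]_d -> \bar R :=
  density_measure (leb R d) (B_density y (QP_density mu)).

Definition kalman_step (mu : set 'cV[R]_d -> \bar R) (y : 'cV[R]_K) :
    set 'cV[R]_d -> \bar R :=
  T_measure y (density_measure (leb R d \x leb R K)%E (QP_density mu)).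

(* mu_J and mu^K_J for the data y_1, ..., y_J listed in Y *)
Definition true_filter (mu0 : set 'cV[R]_d -> \bar R) (Y : seq 'cV[R]_K) :=
  foldl true_step mu0 Y.

Definition kalman_filter (mu0 : set 'cV[R]_d -> \bar R) (Y : seq 'cV[R]_K) :=
  foldl kalman_step mu0 Y.

End operators.

Definition model_ball d K (kappa_Psi kappa_h ell_h : R)
    (Psi0 : 'cV[R]_d -> 'cV[R]_d) (h0 : 'cV[R]_d -> 'cV[R]_K) (r : R) :
    set (('cV[R]_d -> 'cV[R]_d) * ('cV[R]_d -> 'cV[R]_K)) :=
  [set Psih | let Psi := Psih.1 in let h := Psih.2 in
    [/\ measurable_fun setT Psi,
        forall u, enorm (Psi u) <= kappa_Psi &
        forall u, enorm (Psi u - Psi0 u) <= r] /\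
    [/\ continuous h,
        forall u, enorm (h u) <= kappa_h,
        forall u, enorm (h u - h0 u) <= r &
        forall u v, enorm (h u - h v) <= ell_h * enorm (u - v)]].

Definition data_ball K J (kappa_y : R) : set (J.-tuple 'cV[R]_K) :=
  [set Y | forall j, enorm (tnth Y j) <= kappa_y].

End gaussian_filtering.

Arguments data_ball {R} K J kappa_y.

(* Main.v *)
From HB Require Import structures.
Require Import Defs.
From mathcomp Require Import all_boot all_order all_algebra.
From mathcomp Require Import all_classical all_reals all_analysis.
From mathcomp Require Import ring lra.
From mathcomp Require Import measurable_realfun complex.

Set Implicit Arguments.
Unset Strict Implicit.
Unset Printing Implicit Defensive.

Import Order.TTheory GRing.Theory Num.Theory.
Import numFieldNormedType.Exports.

Local Open Scope classical_set_scope.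
Local Open Scope ring_scope.

(** Only the last step of the two recursions matters.  If [Psi] is within [r] of
    the constant [a], then for every law [mu] the prediction is a mixture of
    Gaussians of covariance [Sigma] centred within [r] of [a]; if moreover [h] is
    within [r] of [b], the joint law of state and observation has a density close
    to [ref], the density of the product of N(a, Sigma) and N(b, Gamma).  Under
    that product law state and observation are independent, so that conditioning
    on the observation and the Kalman update, whose gain vanishes, both return
    N(a, Sigma).  It remains to see that each update depends continuously on the
    joint density, uniformly in the data; the two filters are then both within
    O(r) of N(a, Sigma) after any number of steps (step_dg), and delta is taken
    proportional to eps, below a fixed threshold.

    Closeness of a density to [ref] means (close) that the pointwise difference is
    at most O(r) times a slightly wider Gaussian, the weight.  This is what moving
    the centre of a Gaussian produces (gauss_perturb, QP_close), and it is strong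
    enough to integrate test functions of quadratic growth (moment_close).

    For the conditioning (true_step_close) one divides by a normalization that is
    bounded below.  For the Kalman update (kalman_step_close), the gain is O(r)
    because the cross covariance is, while the covariance of the observation is
    bounded below (gain_bound).  As test functions are only measurable, the small
    displacement made by the update cannot be absorbed by them: by translation
    invariance of the Lebesgue measure (integral_shear) it is transferred to the
    density, where it is one more displacement of a Gaussian centre.

    For the induction along the steps both filters have to remain probability
    measures, which rests on the exact value of the Gaussian integral
    (gaussian_integral, by induction on the dimension through Schur complements).
    The weighted norm is written with a square root of a matrix; that it is the
    usual quadratic form comes from the spectral theorem (posdef_sqrt). *)

(** * Linear algebra of positive definite matrices *)

Section linear_algebra.
Context {R : realType}.

Definition nsq n (v : 'cV[R]_n) : R := \sum_i v i ord0 ^+ 2.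

Definition fnorm2 m n (M : 'M[R]_(m, n)) : R := \sum_i \sum_j M i j ^+ 2.

Lemma nsq_ge0 n (v : 'cV[R]_n) : 0 <= nsq v.
Proof. by apply: sumr_ge0 => i _; exact: sqr_ge0. Qed.

Lemma fnorm2_ge0 m n (M : 'M[R]_(m, n)) : 0 <= fnorm2 M.
Proof. by do 2![apply: sumr_ge0 => ? _]; exact: sqr_ge0. Qed.

Lemma nsq0 n : nsq (0 : 'cV[R]_n) = 0.
Proof. by rewrite /nsq big1// => i _; rewrite mxE expr0n. Qed.

Lemma nsq_eq0 n (v : 'cV[R]_n) : nsq v = 0 -> v = 0.
Proof.
move=> /eqP; rewrite psumr_eq0 => [/allP v0|i _]; last exact: sqr_ge0.
apply/colP => i; apply/eqP.
by rewrite mxE -sqrf_eq0; exact: (v0 i (mem_index_enum _)).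
Qed.

Lemma nsq_gt0 n (v : 'cV[R]_n) : v != 0 -> 0 < nsq v.
Proof.
by rewrite lt_def nsq_ge0 andbT; apply: contraNN => /eqP/nsq_eq0 ->.
Qed.

Lemma nsqN n (v : 'cV[R]_n) : nsq (- v) = nsq v.
Proof. by apply: eq_bigr => i _; rewrite mxE sqrrN. Qed.

Lemma nsqD_le n (v w : 'cV[R]_n) : nsq (v + w) <= 2 * nsq v + 2 * nsq w.
Proof.
rewrite !mulr_sumr -big_split /=; apply: ler_sum => i _; rewrite mxE.
by have := sqr_ge0 (v i ord0 - w i ord0); nra.
Qed.

Lemma nsqB_le n (v w : 'cV[R]_n) : nsq (v - w) <= 2 * nsq v + 2 * nsq w.
Proof. by rewrite -(nsqN w); exact: nsqD_le. Qed.

Lemma sqr_entry_le n (v : 'cV[R]_n) i : v i ord0 ^+ 2 <= nsq v.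
Proof.
by rewrite /nsq (bigD1 i)//= lerDl; apply: sumr_ge0 => j _; exact: sqr_ge0.
Qed.

Lemma nsqE n (v : 'cV[R]_n) : nsq v = (v^T *m v) ord0 ord0.
Proof. by rewrite mxE; apply: eq_bigr => i _; rewrite mxE expr2. Qed.

Lemma enorm_sqr n (v : 'cV[R]_n) : enorm v ^+ 2 = nsq v.
Proof. by rewrite sqr_sqrtr// nsq_ge0. Qed.

Lemma enorm_le_nsq n (v : 'cV[R]_n) k : enorm v <= k -> nsq v <= k ^+ 2.
Proof.
by rewrite -enorm_sqr => vk; rewrite lerXn2r ?nnegrE ?(le_trans _ vk)// sqrtr_ge0.
Qed.

(** Lagrange's identity: the gap in the Cauchy-Schwarz inequality is half of
    the sum of the squares of the minors [a i * b j - a j * b i]. *)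
Lemma cauchy_schwarz_sum (I : finType) (a b : I -> R) :
  (\sum_i a i * b i) ^+ 2 <= (\sum_i a i ^+ 2) * (\sum_i b i ^+ 2).
Proof.
suff : 0 <= ((\sum_i a i ^+ 2) * (\sum_i b i ^+ 2) - (\sum_i a i * b i) ^+ 2) *+ 2.
  by rewrite pmulrn_lge0// subr_ge0.
rewrite [X in 0 <= X](_ : _ = \sum_i \sum_j (a i * b j - a j * b i) ^+ 2).
  by do 2![apply: sumr_ge0 => ? _]; exact: sqr_ge0.
have E (F G : I -> R) :
  (\sum_i F i) * (\sum_j G j) = \sum_i \sum_j F i * G j.
  by rewrite mulr_suml; apply: eq_bigr => i _; rewrite mulr_sumr.
rewrite mulrnBl mulr2n {2}mulrC expr2 !E -sumrMnl -big_split/= -sumrB.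
apply: eq_bigr => i _; rewrite -sumrMnl -big_split/= -sumrB.
by apply: eq_bigr => j _; rewrite -mulr_natl; ring.
Qed.

Lemma nsq_mulmx_le m n (M : 'M[R]_(m, n)) (v : 'cV[R]_n) :
  nsq (M *m v) <= fnorm2 M * nsq v.
Proof.
rewrite /fnorm2 mulr_suml; apply: ler_sum => i _; rewrite mxE.
exact: cauchy_schwarz_sum.
Qed.

Lemma posdef_unit n (S : 'M[R]_n) :
  (forall v : 'cV[R]_n, v != 0 -> 0 < (v^T *m S *m v) ord0 ord0) -> S \in unitmx.
Proof.
move=> S0; rewrite -unitmx_tr -row_free_unit -kermx_eq0; apply/rowV0P => u.
move/sub_kermxP => uS; apply/eqP; apply: contraT => u0.
have := S0 u^T; rewrite trmx_eq0 trmxK => /(_ u0).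
suff -> : u *m S *m u^T = 0 by rewrite mxE ltxx.
by rewrite -mulmxA -[S]trmxK -trmx_mul uS trmx0 mulmx0.
Qed.

Lemma posdef_inv n (S : 'M[R]_n) : posdefmx S -> posdefmx (invmx S).
Proof.
move=> [ST S0]; have Su := posdef_unit S0; split; first by rewrite trmx_inv ST.
move=> v v0; have := S0 (invmx S *m v).
have -> : (invmx S *m v != 0) = (v != 0).
  congr negb; apply/eqP/eqP => [Sv|->]; last by rewrite mulmx0.
  by rewrite -(mulKVmx Su v) Sv mulmx0.
by move=> /(_ v0); rewrite trmx_mul trmx_inv ST -!mulmxA mulKVmx.
Qed.

Lemma interpolation (F : fieldType) (s : seq F) (f : F -> F) :
  exists q : {poly F}, forall x, x \in s -> q.[x] = f x.
Proof.
elim: s => [|y s [q qs]]; first by exists 0.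
have [ys|ys] := boolP (y \in s).
  by exists q => x; rewrite inE => /predU1P[->|]; exact: qs.
pose p := \prod_(z <- s) ('X - z%:P).
have py : p.[y] != 0 by rewrite -rootE root_prod_XsubC.
exists (q + ((f y - q.[y]) / p.[y]) *: p) => x; rewrite inE hornerD hornerZ.
move=> /predU1P[->|xs]; first by rewrite divfK// addrC subrK.
have /rootP -> : root p x by rewrite root_prod_XsubC.
by rewrite mulr0 addr0 qs.
Qed.

Lemma tr_horner_mx n (S : 'M[R]_n.+1) (q : {poly R}) :
  S^T = S -> (horner_mx S q)^T = horner_mx S q.
Proof.
move=> ST; elim/poly_ind: q => [|q c IH]; first by rewrite !rmorph0 trmx0.
rewrite rmorphD rmorphM /= horner_mx_X horner_mx_C linearD/= tr_scalar_mx.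
congr (_ + _); rewrite -[_ * S]/(_ *m S) trmx_mul ST IH.
exact: comm_mx_horner (comm_mx_refl _).
Qed.

(** Over the complex numbers a real symmetric matrix is diagonalizable, so
    that it is killed by any polynomial vanishing at its eigenvalues, and these
    are real. *)
Lemma horner_mx_symmetric n (S : 'M[R]_n.+1) : S^T = S ->
  exists s : seq R, all (eigenvalue S) s /\
    forall p : {poly R}, (forall x, x \in s -> p.[x] = 0) -> horner_mx S p = 0.
Proof.
move=> ST; pose f : {rmorphism R -> R[i]} := real_complex R; pose Sc := map_mx f S.
have Sh : Sc \is hermsymmx.
  apply: realsym_hermsym.
    apply/is_hermitianmxP; rewrite expr0 scale1r map_mx_id// /Sc.
    by apply/matrixP => i j; rewrite !mxE -[in RHS]ST mxE.
  by apply/mxOverP => i j; rewrite mxE complex_real.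
have Sn := hermitian_normalmx Sh.
have /orthomx_spectralP := Sn.
have := hermitian_spectral_diag_real Sh; have := spectral_unit Sc.
set P := spectralmx Sc; set sp := spectral_diag Sc => Pu /mxOverP spR SE.
pose r i := complex.Re (sp ord0 i).
have rE i : sp ord0 i = f (r i) by rewrite -[LHS](RRe_real (spR ord0 i)).
exists [seq r i | i : 'I_n.+1]; split.
  apply/allP => _ /mapP[i _ ->]; rewrite eigenvalue_root_char -(fmorph_root f).
  rewrite map_char_poly -eigenvalue_root_char.
  rewrite [X in eigenvalue _ X](_ : _ = sp ord0 i) ?rE//; apply/eigenvalueP.
  exists (row i P); last first.
    apply/eqP => Pi; have := mulmxV Pu => /(congr1 (row i)).
    rewrite row_mul Pi mul0mx => /rowP/(_ i)/eqP.
    by rewrite !mxE eqxx eq_sym oner_eq0.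
  rewrite -row_mul; have -> : P *m map_mx f S = diag_mx sp *m P.
    by rewrite [map_mx f S]SE -!mulmxA mulKVmx.
  by rewrite row_mul row_diag_mx rE -scalemxAl -rowE.
move=> p p0; apply/eqP; rewrite -(map_mx_eq0 f); apply/eqP.
rewrite map_horner_mx [map_mx f S]SE.
rewrite (@horner_mx_uconjC _ _ _ P (diag_mx sp) Pu) horner_mx_diag.
rewrite (_ : map_mx _ sp = 0) ?map_mx0 ?linear0 ?mulmx0 ?mul0mx//.
apply/rowP => i; rewrite !mxE rE horner_map/= p0 ?rmorph0//.
by apply/mapP; exists i => //; rewrite mem_enum.
Qed.

(** The square root is [C ^+ 2] where [C] is a polynomial in [S] with
    [C ^+ 4 = S]: being a polynomial makes [C] symmetric, and then its square
    is positive. *)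
Lemma posdef_sqrt n (S : 'M[R]_n) :
  posdefmx S -> exists B, posdefmx B /\ B *m B = S.
Proof.
case: n S => [S PS|n S [ST S0]]; first by exists S; split=> //; apply/matrixP => -[].
have [s [sS Ss]] := horner_mx_symmetric ST.
have [q qs] := interpolation s (fun x => Num.sqrt (Num.sqrt x)).
have s_ge0 x : x \in s -> 0 <= x.
  move=> /(allP sS)/eigenvalueP[u uS u0].
  have uT0 : u^T != 0 by rewrite trmx_eq0.
  have := S0 _ uT0; rewrite trmxK uS -scalemxAl mxE.
  by have := nsq_gt0 uT0; rewrite nsqE trmxK => /pmulr_lgt0 ->; exact: ltW.
pose C := horner_mx S q.
have CT : C^T = C by exact: tr_horner_mx.
have C4 : (C *m C) *m (C *m C) = S.
  apply/eqP; rewrite -subr_eq0; apply/eqP.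
  rewrite -(Ss (q * q * (q * q) - 'X)) => [|x xs].
    by rewrite rmorphB !rmorphM /= horner_mx_X.
  rewrite hornerD hornerN hornerX !hornerM qs// -!expr2 !sqr_sqrtr ?sqrtr_ge0//.
    by rewrite subrr.
  exact: s_ge0.
exists (C *m C); split=> //; split; first by rewrite trmx_mul CT.
move=> v v0.
have -> : v^T *m (C *m C) *m v = (C *m v)^T *m (C *m v).
  by rewrite trmx_mul CT !mulmxA.
rewrite -nsqE; apply: nsq_gt0; apply/eqP => Cv.
by have := S0 v v0; rewrite -C4 -!mulmxA Cv !mulmx0 mxE ltxx.
Qed.

Lemma sqrtmxP n (S : 'M[R]_n) : posdefmx S ->
  posdefmx (sqrtmx S) /\ sqrtmx S *m sqrtmx S = S.
Proof.
move=> /posdef_sqrt[B BP]; rewrite /sqrtmx.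
by case: xgetP => [C _ []//|nB]; case: (nB B BP).
Qed.

Lemma wnorm_sqr n (S : 'M[R]_n) v :
  wnorm S v ^+ 2 = nsq (sqrtmx (invmx S) *m v).
Proof. exact: enorm_sqr. Qed.

Lemma nsq_sqrtmx n (S : 'M[R]_n) v : posdefmx S ->
  nsq (sqrtmx S *m v) = (v^T *m S *m v) ord0 ord0.
Proof.
move=> /sqrtmxP[[BT _] BB]; rewrite nsqE trmx_mul BT -!mulmxA.
by rewrite [in LHS](mulmxA (sqrtmx S)) BB.
Qed.

(** The constant is the squared norm of the inverse; adding 1 makes it positive
    in dimension 0 too. *)
Lemma nsq_sqrtmx_coercive n (S : 'M[R]_n) : posdefmx S ->
  exists2 c, 0 < c & forall v, nsq v <= c * nsq (sqrtmx S *m v).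
Proof.
move=> /sqrtmxP[[_ /posdef_unit Bu] _].
exists (fnorm2 (invmx (sqrtmx S)) + 1) => [|v].
  by rewrite ltr_wpDl ?fnorm2_ge0.
rewrite -{1}(mulKmx Bu v) (le_trans (nsq_mulmx_le _ _))// ler_wpM2r ?nsq_ge0//.
by rewrite lerDl.
Qed.

Lemma det_posdef_gt0 n (S : 'M[R]_n) : posdefmx S -> 0 < \det S.
Proof.
move=> /sqrtmxP[[_ /posdef_unit Bu] <-]; rewrite det_mulmx -expr2.
by rewrite exprn_even_gt0//= -unitfE -unitmxE.
Qed.

End linear_algebra.

(** * Measurability of vector-valued maps *)

Section measurable_matrices.
Context {R : realType}.
Context d (T : measurableType d).

Lemma measurable_fun_entry m n (f : T -> 'M[R]_(m, n)) i j :
  measurable_fun setT f -> measurable_fun setT (fun x => f x i j : R).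
Proof. by move=> mf; exact: measurableT_comp (measurable_coord i j) mf. Qed.

Lemma measurable_mxD m n (f g : T -> 'M[R]_(m, n)) :
  measurable_fun setT f -> measurable_fun setT g ->
  measurable_fun setT (fun x => f x + g x).
Proof.
move=> mf mg; apply: measurable_fun_mx => i j; under eq_fun do rewrite mxE.
by apply: measurable_funD; exact: measurable_fun_entry.
Qed.

Lemma measurable_mxM m n p (M : 'M[R]_(m, n)) (f : T -> 'M[R]_(n, p)) :
  measurable_fun setT f -> measurable_fun setT (fun x => M *m f x).
Proof.
move=> mf; apply: measurable_fun_mx => i j; under eq_fun do rewrite mxE.
apply: measurable_sum => k; apply: measurable_funM => //.
exact: measurable_fun_entry.
Qed.

Lemma measurable_mxN m n (f : T -> 'M[R]_(m, n)) :
  measurable_fun setT f -> measurable_fun setT (fun x => - f x).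
Proof.
move=> mf; apply: measurable_fun_mx => i j; under eq_fun do rewrite mxE.
by apply: measurableT_comp => //; exact: measurable_fun_entry.
Qed.

Lemma measurable_mxB m n (f g : T -> 'M[R]_(m, n)) :
  measurable_fun setT f -> measurable_fun setT g ->
  measurable_fun setT (fun x => f x - g x).
Proof. by move=> mf mg; apply: measurable_mxD => //; exact: measurable_mxN. Qed.

Lemma measurable_nsq n (f : T -> 'cV[R]_n) :
  measurable_fun setT f -> measurable_fun setT (fun x => nsq (f x)).
Proof.
move=> mf; apply: measurable_sum => i; apply: measurable_funX.
exact: measurable_fun_entry.
Qed.

End measurable_matrices.

(** * Lebesgue measure on column vectors *)

Section lebesgue_cV.
Context {R : realType}.
Local Open Scope ereal_scope.

Lemma leb_tonelli n (f : 'cV[R]_n.+1 -> \bar R) :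
  measurable_fun setT f -> (forall x, 0 <= f x) ->
  \int[leb R n.+1]_x f x =
  \int[leb R n]_v \int[lebesgue_measure]_t f (cv_cons (t, v)).
Proof.
move=> mf f0.
have mc := @measurable_cv_cons R n.
transitivity (\int[(lebesgue_measure \x leb R n)]_z f (cv_cons z)).
  exact: (@ge0_integral_pushforward _ _ _ _ R _ mc
    (lebesgue_measure \x leb R n) setT f).
by rewrite fubini_tonelli2//; exact: measurableT_comp.
Qed.

Lemma lebesgue_measure_shift (t : R) (A : set (measurableTypeR R)) :
  measurable A ->
  lebesgue_measure ((fun x => (x + t)%R) @^-1` A) = lebesgue_measure A.
Proof.
have mt : measurable_fun setT
    (fun x : measurableTypeR R => (x + t)%R : measurableTypeR R).
  exact: measurable_funD.
pose phi : {mfun measurableTypeR R >-> measurableTypeR R} :=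
  HB.pack (fun x : measurableTypeR R => (x + t)%R : measurableTypeR R)
    (isMeasurableFun.Build _ _ _ _ _ mt).
move=> mA; apply/esym.
apply: (lebesgue_measure_unique (mu := pushforward lebesgue_measure phi)) => //.
move=> _ [[a b] _ <-].
change (lebesgue_measure ([set` `]a, b]%R] : set (measurableTypeR R)) =
  lebesgue_measure (phi @^-1` [set` `]a, b]%R])).
have -> : phi @^-1` [set` `]a, b]%R] = [set` `](a - t)%R, (b - t)%R]%R].
  by apply/seteqP; split => x /=; rewrite !in_itv/= ltrBlDr lerBrDr.
rewrite !lebesgue_measure_itv/= !lte_fin ltrD2r.
by case: ifPn => // _; rewrite -!EFinB; congr EFin; ring.
Qed.

Lemma lebesgue_integral_shift (t : R) (f : measurableTypeR R -> \bar R) :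
  measurable_fun setT f -> (forall x, 0 <= f x) ->
  \int[lebesgue_measure]_x f (x + t)%R = \int[lebesgue_measure]_x f x.
Proof.
move=> mf f0.
have mt : measurable_fun setT
    (fun x : measurableTypeR R => (x + t)%R : measurableTypeR R).
  exact: measurable_funD.
transitivity (\int[pushforward lebesgue_measure
  (fun x : measurableTypeR R => (x + t)%R : measurableTypeR R)]_x f x).
  by rewrite (ge0_integral_pushforward mt).
by apply: eq_measure_integral => A mA _; exact: lebesgue_measure_shift.
Qed.

Lemma cv_consD n t s (v w : 'cV[R]_n) :
  cv_cons ((t + s)%R, (v + w)%R) = (cv_cons (t, v) + cv_cons (s, w))%R.
Proof.
by apply/colP => i; rewrite !mxE; case: fintype.split => j; rewrite !mxE/= ?mulrnDl.
Qed.

Lemma cv_unconsK n : cancel (@cv_uncons R n) (@cv_cons R n).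
Proof.
move=> v; apply/colP => i; rewrite mxE; case: splitP => j ij; rewrite !mxE/=.
  rewrite (ord1 j) eqxx mulr1n; congr (v _ _).
  by apply: val_inj; rewrite /= ij (ord1 j).
by congr (v _ _); apply: val_inj; rewrite /= ij.
Qed.

(** One coordinate at a time, the translation invariance of the measure of [R]
    gives that of the iterated product. *)
Lemma leb_integral_shift n (w : 'cV[R]_n) (f : 'cV[R]_n -> \bar R) :
  measurable_fun setT f -> (forall x, 0 <= f x) ->
  \int[leb R n]_x f (x + w)%R = \int[leb R n]_x f x.
Proof.
elim: n => [|n IH] in w f *; move=> mf f0.
  by apply: eq_integral => x _; rewrite (flatmx0 (x + w)%R) (flatmx0 x).
have mc := @measurable_cv_cons R n.
have msh : measurable_fun setT (fun x : 'cV[R]_n.+1 => f (x + w)%R).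
  by apply: measurableT_comp => //; apply: measurable_mxD.
rewrite (leb_tonelli msh (fun x => f0 _)) (leb_tonelli mf f0).
have [s [v wE]] : exists s v, w = cv_cons (s, v).
  exists (cv_uncons w).1, (cv_uncons w).2.
  by rewrite -surjective_pairing cv_unconsK.
have mfc v' : measurable_fun setT (fun t => f (cv_cons (t, v'))).
  by apply: measurableT_comp => //; apply: measurableT_comp.
pose g v' := \int[lebesgue_measure]_t f (cv_cons (t, v')).
rewrite -[RHS](IH v g).
- apply: eq_integral => v' _; rewrite /g.
  rewrite -[RHS](lebesgue_integral_shift s)//.
  by apply: eq_integral => t _; rewrite wE -cv_consD.
- apply: (@measurable_fun_fubini_tonelli_G _ _ _ _ R lebesgue_measure
    (fun z => f (cv_cons z))) => //.
  exact: measurableT_comp.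
- by move=> x; exact: integral_ge0.
Qed.

(** This is the total mass of the normal law of mean [- s] and variance
    [a^-1]. *)
Lemma integral_gauss1 (a s : R) : (0 < a)%R ->
  \int[lebesgue_measure]_t (expR (- 2^-1 * (a * (t + s) ^+ 2)))%:E =
  (Num.sqrt (2 * pi / a))%:E.
Proof.
move=> a0; pose sg : R := ((Num.sqrt a)^-1)%R.
have sg0 : sg != 0%R by rewrite invr_eq0 gt_eqF ?sqrtr_gt0.
have sgE : (sg ^+ 2 = a^-1)%R by rewrite exprVn sqr_sqrtr// ltW.
have p0 := normal_peak_gt0 sg0.
have pE : ((normal_peak sg)^-1 = Num.sqrt (2 * pi / a))%R.
  by rewrite /normal_peak invrK sgE; congr Num.sqrt; rewrite -(mulr_natl _ 2); ring.
have := integral_normal_pdf (- s) sg; rewrite normal_pdfE//.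
under eq_integral do rewrite EFinM.
rewrite ge0_integralZl//=; last 3 first.
- by apply/measurable_EFinP; exact: measurable_normal_fun.
- by move=> t _; rewrite lee_fin normal_fun_ge0.
- by rewrite lee_fin normal_peak_ge0.
move=> /(congr1 (fun x => ((normal_peak sg)^-1)%R%:E * x)).
rewrite mule1 muleA -EFinM mulVf ?gt_eqF// mul1e pE => <-.
apply: eq_integral => t _; rewrite /normal_fun opprK sgE.
by congr (expR _)%:E; rewrite -mulr_natl; field; rewrite gt_eqF.
Qed.

End lebesgue_cV.

(** * Gaussian integrals and boxes *)

Section gaussian_integral.
Context {R : realType}.

Lemma qf_cv_cons n (A : 'M[R]_n.+1) t (v : 'cV[R]_n) : A^T = A ->
  let a := A ord0 ord0 in
  let b : 'cV[R]_n := dlsubmx (A : 'M[R]_(1 + n)) in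
  let D : 'M[R]_n := drsubmx (A : 'M[R]_(1 + n)) in
  ((cv_cons (t, v))^T *m A *m cv_cons (t, v)) ord0 ord0 =
  a * t ^+ 2 + 2 * t * (b^T *m v) ord0 ord0 + (v^T *m D *m v) ord0 ord0.
Proof.
move=> AT a b D; rewrite /cv_cons/=.
have AE : A = block_mx (a%:M : 'M[R]_1) (b^T) b D :> 'M[R]_(1 + n).
  rewrite -[LHS](@submxK _ 1 n 1 n); congr block_mx.
    apply/matrixP => i j; rewrite !ord1 !mxE eqxx mulr1n.
    by congr (A _ _); exact: val_inj.
  by rewrite trmx_dlsub AT.
rewrite AE (@tr_col_mx _ 1 n 1) tr_scalar_mx (@mul_row_block _ 1 1 n 1 n).
rewrite (@mul_row_col _ 1 1 n 1) !mulmxDl.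
have [c cE] : exists c : R, b^T *m v = c%:M :> 'M[R]_1.
  by exists ((b^T *m v) ord0 ord0); exact: mx11_scalar.
have cE' : v^T *m b = c%:M :> 'M[R]_1 by rewrite -[b]trmxK -trmx_mul cE tr_scalar_mx.
rewrite cE cE' -!scalar_mxM -mulmxA cE -scalar_mxM !mxE eqxx !mulr1n.
by rewrite /=; ring.
Qed.

Definition schur n (A : 'M[R]_n.+1) : 'M[R]_n :=
  let b : 'cV[R]_n := dlsubmx (A : 'M[R]_(1 + n)) in
  drsubmx (A : 'M[R]_(1 + n)) - (A ord0 ord0)^-1 *: (b *m b^T).

Section schur_complement.
Variables (n : nat) (A : 'M[R]_n.+1).
Hypothesis PA : posdefmx A.

Let a := A ord0 ord0.
Let b : 'cV[R]_n := dlsubmx (A : 'M[R]_(1 + n)).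

Lemma posdef_corner : 0 < a.
Proof.
have [AT A0] := PA; have := A0 (cv_cons (1, 0)).
rewrite qf_cv_cons// expr1n mulr1 !mulmx0 !mxE mulr0 !addr0; apply.
apply/eqP => /(congr1 (@cv_uncons R n)); rewrite cv_consK => -[+ _].
by rewrite !mxE => /eqP; rewrite oner_eq0.
Qed.

(** Completing the square in the first coordinate. *)
Lemma qf_schur t (v : 'cV[R]_n) :
  ((cv_cons (t, v))^T *m A *m cv_cons (t, v)) ord0 ord0 =
  a * (t + (b^T *m v) ord0 ord0 / a) ^+ 2 + (v^T *m schur A *m v) ord0 ord0.
Proof.
have [AT A0] := PA; have a0 := posdef_corner; rewrite qf_cv_cons// -/a -/b.
have BE (M N : 'M[R]_1) c : (M - c *: N) ord0 ord0 = M ord0 ord0 - c * N ord0 ord0.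
  by rewrite !mxE.
rewrite /schur -/b mulmxBr mulmxBl -scalemxAr -scalemxAl BE.
have -> : (v^T *m (b *m b^T) *m v) ord0 ord0 = (b^T *m v) ord0 ord0 ^+ 2.
  rewrite (mx11_scalar (b^T *m v)) mulmxA -mulmxA (mx11_scalar (b^T *m v)).
  rewrite -[v^T *m b]trmxK trmx_mul trmxK (mx11_scalar (b^T *m v)) tr_scalar_mx.
  by rewrite -scalar_mxM !mxE eqxx !mulr1n expr2.
by rewrite -/a; field; rewrite gt_eqF.
Qed.

(** The Schur complement gives the minimum of the quadratic form over the first
    coordinate. *)
Lemma posdef_schur : posdefmx (schur A).
Proof.
have [AT A0] := PA; split.
  rewrite /schur linearB linearZ /= trmx_mul trmxK; congr (_ - _).
  by rewrite trmx_drsub AT.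
move=> v v0; have a0 := posdef_corner.
have := A0 (cv_cons (- ((b^T *m v) ord0 ord0 / a), v)).
rewrite qf_schur addNr expr0n mulr0 add0r; apply.
apply: contraNneq v0 => /(congr1 (@cv_uncons R n)); rewrite cv_consK => -[_ ->].
by apply/eqP/colP => i; rewrite !mxE.
Qed.

(** Block LU factorization. *)
Lemma det_schur : \det A = a * \det (schur A).
Proof.
have [AT A0] := PA; have a0 := posdef_corner.
pose L := block_mx (1%:M : 'M[R]_1) 0 (a^-1 *: b) 1%:M.
pose U := block_mx (a%:M : 'M[R]_1) (b^T) 0 (schur A).
have AE : A = L *m U :> 'M[R]_(1 + n).
  rewrite /L /U (@mulmx_block _ 1 n 1 n 1 n) !mul1mx !mul0mx !addr0.
  rewrite -[LHS](@submxK _ 1 n 1 n); congr block_mx.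
  - apply/matrixP => i j; rewrite !ord1 !mxE eqxx mulr1n.
    by congr (A _ _); exact: val_inj.
  - by rewrite trmx_dlsub AT.
  - by rewrite mul_mx_scalar scalerA divff ?gt_eqF// scale1r.
  - by rewrite /schur -scalemxAl addrC subrK.
have := congr1 (fun M : 'M[R]_(1 + n) => \det M) AE.
rewrite det_mulmx det_lblock det_ublock.
by rewrite !det1 !mul1r det_scalar1.
Qed.

End schur_complement.

(** By qf_schur the integral over the first coordinate is one-dimensional, and
    what is left is the integral for the Schur complement. *)
Lemma gaussian_integral n (A : 'M[R]_n) : posdefmx A ->
  (\int[leb R n]_x (expR (- 2^-1 * (x^T *m A *m x) ord0 ord0))%:E =
   (Num.sqrt ((2 * pi) ^+ n / \det A))%:E)%E.
Proof.
have mqf m (M : 'M[R]_m) : posdefmx M -> measurable_fun setT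
    (fun x : 'cV[R]_m => (expR (- 2^-1 * (x^T *m M *m x) ord0 ord0))%:E).
  move=> PM; apply/measurable_EFinP; apply: measurableT_comp => //.
  under eq_fun do rewrite -nsq_sqrtmx//.
  by apply: measurable_funM => //; apply: measurable_nsq; exact: measurable_mxM.
elim: n A => [|n IH] A PA.
  rewrite /= integral_dirac//; last exact: mqf.
  rewrite diracT mul1e mulmx0 mxE mulr0 expR0 det_mx00 expr0 divr1 sqrtr1.
  by [].
rewrite leb_tonelli//; last exact: mqf.
have a0 := posdef_corner PA; set a := A ord0 ord0 in a0 *.
have PS := posdef_schur PA.
under eq_integral => v _.
  under eq_integral => t _ do
    rewrite (qf_schur PA) mulrDr expRD EFinM.
  rewrite ge0_integralZr//=; last first.
    apply/measurable_EFinP; apply: measurableT_comp => //.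
    apply: measurable_funM => //; apply: measurable_funM => //.
    by apply: measurable_funX; exact: measurable_funD.
  rewrite integral_gauss1//.
  over.
rewrite ge0_integralZl//=; last exact: mqf.
rewrite IH// -EFinM -sqrtrM; last by rewrite divr_ge0 ?mulr_ge0 ?pi_ge0// ltW.
congr (Num.sqrt _)%:E; rewrite (det_schur PA) -/a exprS.
by field; rewrite !gt_eqF// det_posdef_gt0.
Qed.

Lemma posdefZ n (A : 'M[R]_n) (c : R) : 0 < c -> posdefmx A -> posdefmx (c *: A).
Proof.
move=> c0 [AT A0]; split; first by rewrite linearZ/= AT.
by move=> v /A0 v0; rewrite -scalemxAr -scalemxAl mxE mulr_gt0.
Qed.

Lemma gauss_factor_gt0 n (S : 'M[R]_n) : posdefmx S -> 0 < gauss_factor S.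
Proof.
move=> /det_posdef_gt0 S0; rewrite invr_gt0 sqrtr_gt0 mulr_gt0// exprn_gt0//.
by rewrite mulr_gt0 ?pi_gt0.
Qed.

Lemma measurable_expR_nsq d (T : measurableType d) n c (M : 'M[R]_n)
    (f : T -> 'cV[R]_n) : measurable_fun setT f ->
  measurable_fun setT (fun x => expR (c * nsq (M *m f x))).
Proof.
move=> mf; apply: measurableT_comp => //; apply: measurable_funM => //.
by apply: measurable_nsq; exact: measurable_mxM.
Qed.

Lemma gaussian_density_integral n (S : 'M[R]_n) (m : 'cV[R]_n) : posdefmx S ->
  (\int[leb R n]_x
    (gauss_factor S * expR (- 2^-1 * wnorm S (x - m) ^+ 2))%:E = 1)%E.
Proof.
move=> PS; have PI := posdef_inv PS.
under eq_integral do rewrite wnorm_sqr.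
have mg (f : 'cV[R]_n -> 'cV[R]_n) : measurable_fun setT f -> measurable_fun setT
    (fun x => (expR (- 2^-1 * nsq (sqrtmx (invmx S) *m f x)))%:E).
  by move=> mf; apply/measurable_EFinP; exact: measurable_expR_nsq.
have msub : measurable_fun setT (fun x : 'cV[R]_n => x - m) by exact: measurable_mxB.
under eq_integral do rewrite EFinM.
rewrite ge0_integralZl//=; [|exact: mg|by rewrite lee_fin ltW// gauss_factor_gt0].
rewrite (leb_integral_shift (- m) (f := fun x =>
  (expR (- 2^-1 * nsq (sqrtmx (invmx S) *m x)))%:E))//; last exact: mg.
under eq_integral do rewrite nsq_sqrtmx//.
rewrite gaussian_integral// -EFinM; congr EFin.
rewrite /gauss_factor det_inv invrK mulVf// gt_eqF// -invr_gt0.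
exact: gauss_factor_gt0.
Qed.

Lemma integral_expR_nsq_lty n (S : 'M[R]_n) (m : 'cV[R]_n) (c : R) :
  posdefmx S -> 0 < c ->
  (\int[leb R n]_x (expR (- c * nsq (sqrtmx S *m (x - m))))%:E < +oo)%E.
Proof.
move=> PS c0; have PcS : posdefmx ((2 * c) *: S).
  by apply: posdefZ => //; rewrite mulr_gt0.
rewrite (leb_integral_shift (- m) (f := fun x =>
  (expR (- c * nsq (sqrtmx S *m x)))%:E))//; last first.
  by apply/measurable_EFinP; exact: measurable_expR_nsq.
under eq_integral => x _.
  rewrite (_ : - c * _ = - 2^-1 * (x^T *m ((2 * c) *: S) *m x) ord0 ord0); last first.
    by rewrite nsq_sqrtmx// -scalemxAr -scalemxAl [in RHS]mxE; field.
  over.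
by rewrite gaussian_integral// ltry.
Qed.

(** The orthant in which the box lies is a parameter, because unit_box_linear
    has to choose it. *)
Definition unit_box n (sg : 'I_n -> bool) : set 'cV[R]_n :=
  [set x | forall i, 1 <= (-1) ^+ sg i * x i ord0 <= 2].

Lemma unit_box_cons n (sg : 'I_n.+1 -> bool) t (v : 'cV[R]_n) :
  unit_box sg (cv_cons (t, v)) <->
  (1 <= (-1) ^+ sg ord0 * t <= 2 /\ unit_box (fun i => sg (lift ord0 i)) v).
Proof.
have E0 : cv_cons (t, v) ord0 ord0 = t.
  by have := cv_consK (t, v) => -[].
have E1 i : cv_cons (t, v) (lift ord0 i) ord0 = v i ord0.
  rewrite mxE; case: splitP => j /=; first by rewrite ord1.
  by move=> [ij]; congr (v _ _); apply: val_inj; exact: esym.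
split=> [H|[H0 H1] i].
  by split=> [|i]; [have := H ord0; rewrite E0|have := H (lift ord0 i); rewrite E1].
by case: (unliftP ord0 i) => [j|] ->; rewrite ?E0// E1; exact: H1.
Qed.

Lemma measurable_unit_box n (sg : 'I_n -> bool) : measurable (unit_box sg).
Proof.
rewrite (_ : unit_box sg = \bigcap_(i in [set: 'I_n])
    (fun x : 'cV[R]_n => (-1) ^+ sg i * x i ord0) @^-1` `[1, 2]).
  apply: fin_bigcap_measurable => // i _; rewrite -[X in measurable X]setTI.
  have mf : measurable_fun setT (fun x : 'cV[R]_n => (-1) ^+ sg i * x i ord0 : R).
    by apply: measurable_funM => //; exact: measurable_coord.
  exact: mf.
apply/seteqP; split=> x /= H i; last by have /= := H i Logic.I; rewrite ?in_itv.
by move=> _ /=; rewrite ?in_itv; exact: H.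
Qed.

Lemma leb_unit_box n (sg : 'I_n -> bool) : leb R n (unit_box sg) = 1%E.
Proof.
elim: n sg => [|n IH] sg.
  by rewrite /= diracE mem_set// => -[].
change (pushforward (lebesgue_measure \x leb R n)%E (@cv_cons R n) (unit_box sg) = 1%E).
rewrite /pushforward.
have -> : @cv_cons R n @^-1` unit_box sg =
    [set` if sg ord0 then `[-2, -1] else `[1, 2] : interval R]
    `*` unit_box (fun i => sg (lift ord0 i)).
  apply/seteqP; split=> -[t v] /=; rewrite unit_box_cons => -[H ?]; split=> //=;
   move: H; case: (sg ord0);
   rewrite ?expr0 ?expr1 ?mul1r ?mulN1r in_itv/= => /andP[? ?];
   apply/andP; split; lra.
rewrite product_measure1E//; last exact: measurable_unit_box.
rewrite IH mule1; apply: etrans (lebesgue_measure_itv _) _.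
case: (sg ord0); rewrite /= lte_fin ifT ?ltrN2 ?ltr1n//= -?EFinN -EFinD;
  by congr EFin; lra.
Qed.

End gaussian_integral.

(** * Measures given by a density *)

Section signed_integrals.
Context d1 d2 (T1 : measurableType d1) (T2 : measurableType d2) (R : realType).
Variables (m1 : {measure set T1 -> \bar R}) (m2 : {measure set T2 -> \bar R}).
Variables (phi : T2 -> T1) (k : T2 -> R).
Hypotheses (k0 : forall x, 0 <= k x)
  (m12 : forall f : T1 -> \bar R, measurable_fun setT f -> (forall x, 0 <= f x)%E ->
    (\int[m1]_x f x = \int[m2]_x (f (phi x) * (k x)%:E))%E).

(** The weight [k] being nonnegative, multiplying by it commutes with taking
    positive and negative parts. *)
Lemma signed_integral_transfer (f : T1 -> R) : measurable_fun setT f ->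
  (\int[m1]_x (f x)%:E = \int[m2]_x (f (phi x) * k x)%:E)%E.
Proof.
move=> mf; have mfE : measurable_fun setT (EFin \o f) by exact/measurable_EFinP.
rewrite [LHS]integralE [RHS]integralE !m12//.
- congr (_ - _)%E; apply: eq_integral => x _.
    by rewrite !funeposE/= -!EFin_max -EFinM maxr_pMl ?mul0r.
  by rewrite !funenegE/= -!EFin_max -EFinM maxr_pMl ?mul0r ?mulNr.
- exact: measurable_funeneg.
- exact: measurable_funepos.
Qed.

End signed_integrals.

Section density_measures.
Context d (T : measurableType d) (R : realType).
Variables (m : {measure set T -> \bar R}) (p : T -> R).
Hypotheses (mp : measurable_fun setT p) (p0 : forall x, 0 <= p x).

Let mpE D : measurable_fun D (EFin \o p).
Proof. by apply/measurable_funTS/measurable_EFinP. Qed.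

Let nu0 : density_measure m p set0 = 0%E.
Proof. by rewrite /density_measure integral_set0. Qed.

Let nu_ge0 A : (0 <= density_measure m p A)%E.
Proof. by apply: integral_ge0 => x _; rewrite lee_fin. Qed.

Let nu_sigma_additive : semi_sigma_additive (density_measure m p).
Proof.
move=> /= A mA tA mUA; rewrite /density_measure ge0_integral_bigcup//=.
- apply: is_cvg_ereal_nneg_natsum_cond => n _ _.
  by apply: integral_ge0 => x _; rewrite lee_fin.
- by move=> x _; rewrite lee_fin.
Qed.

(** [density_measure] is a bare set function; the lemmas on integrals ask for a
    measure structure on it. *)
Lemma density_measureP :
  exists nu : {measure set T -> \bar R}, density_measure m p = nu.
Proof.
pose nu : {measure set T -> \bar R} := HB.pack (density_measure m p)
  (isMeasure.Build _ _ _ (density_measure m p) nu0 nu_ge0 nu_sigma_additive).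
by exists nu.
Qed.

Import HBNNSimple.

(** By monotone convergence from simple functions, for which it is the
    definition of the density measure. *)
Lemma ge0_integral_density (f : T -> \bar R) :
  measurable_fun setT f -> (forall x, 0 <= f x)%E ->
  (\int[density_measure m p]_x f x = \int[m]_x (f x * (p x)%:E))%E.
Proof.
move=> mf f0; pose h := nnsfun_approx measurableT mf.
have [nu nuE] := density_measureP.
have -> : (\int[density_measure m p]_x f x =
    lim (\int[nu]_x (EFin \o h n) x @[n --> \oo]))%E.
  rewrite nuE -monotone_convergence//.
  - by apply: eq_integral => x _; apply/esym/cvg_lim => //; exact: cvg_nnsfun_approx.
  - by move=> n; exact/measurable_EFinP.
  - by move=> n x _; rewrite lee_fin.
  - by move=> x _ i j ij; rewrite lee_fin; exact/lefP/nd_nnsfun_approx.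
have -> : (\int[m]_x (f x * (p x)%:E) =
    lim (\int[m]_x ((EFin \o h n) x * (p x)%:E) @[n --> \oo]))%E.
  rewrite -monotone_convergence//.
  - apply: eq_integral => x _; apply/esym/cvg_lim => //.
    by apply: cvgeZr => //; exact: cvg_nnsfun_approx.
  - by move=> n; apply: emeasurable_funM; [exact/measurable_EFinP|exact: mpE].
  - by move=> n x _; rewrite mule_ge0 ?lee_fin.
  - move=> x _ i j ij; rewrite lee_wpmul2r ?lee_fin//.
    exact/lefP/nd_nnsfun_approx.
suff suf n : (\int[nu]_x (EFin \o h n) x =
    \int[m]_x ((EFin \o h n) x * (p x)%:E))%E by under eq_fun do rewrite suf.
transitivity (\int[nu]_x (\sum_(y \in range (h n))
    (y * \1_(h n @^-1` [set y]) x)%:E))%E.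
  by apply: eq_integral => t _; rewrite /= fimfunE -fsumEFin.
have indich y : measurable_fun setT (fun x => (y * \1_(h n @^-1` [set y]) x)%:E).
  by apply/measurable_EFinP; exact: measurable_funM.
rewrite ge0_integral_fsum//; last by move=> y x _; exact: nnfun_muleindic_ge0.
transitivity (\int[m]_x (\sum_(y \in range (h n))
    (y * \1_(h n @^-1` [set y]) x)%:E * (p x)%:E))%E; last first.
  under eq_integral => x _.
    rewrite -ge0_mule_fsuml => [|y]; last exact: nnfun_muleindic_ge0.
    rewrite fsumEFin// -(fimfunE _ x); over.
  by [].
rewrite ge0_integral_fsum//; last 2 first.
- by move=> y; apply: emeasurable_funM; [exact: indich|exact: mpE].
- move=> y x _; apply: mule_ge0; last by rewrite lee_fin.
  exact: nnfun_muleindic_ge0.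
apply: eq_fsbigr => y _.
rewrite integralZl_indic_nnsfun// integral_indic// setIT -nuE /density_measure.
under [RHS]eq_integral do rewrite EFinM -muleA.
have [y0|y0] := ltP y 0.
  rewrite preimage_nnfun0// integral_set0 mule0 integral0_eq// => x _.
  by rewrite indicE in_set0 mul0e mule0.
rewrite ge0_integralZl//=; last 2 first.
- by apply: emeasurable_funM; [exact/measurable_EFinP|exact: mpE].
- by move=> x _; rewrite mule_ge0 ?lee_fin.
congr (_ * _)%E; rewrite integral_mkcond; apply: eq_integral => x _.
rewrite /patch indicE; case: ifPn => _; rewrite ?mul1e//.
by rewrite mul0e.
Qed.

Lemma integral_density (f : T -> R) : measurable_fun setT f ->
  (\int[density_measure m p]_x (f x)%:E = \int[m]_x (f x * p x)%:E)%E.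
Proof.
have [nu nuE] := density_measureP; have E := ge0_integral_density.
by rewrite nuE in E *; exact: (signed_integral_transfer p0 E).
Qed.

Lemma density_probability : (\int[m]_x (p x)%:E = 1)%E ->
  exists P : probability T R, density_measure m p = P.
Proof.
move=> p1; have nuT : density_measure m p setT = 1%E by [].
pose nu : {measure set T -> \bar R} := HB.pack (density_measure m p)
  (isMeasure.Build _ _ _ (density_measure m p) nu0 nu_ge0 nu_sigma_additive).
pose P : probability T R := HB.pack (density_measure m p) (Measure.class nu)
  (Measure_isProbability.Build _ _ _ nu nuT).
by exists P.
Qed.

End density_measures.

Section integral_comparison.
Context d (T : measurableType d) (R : realType) (m : {measure set T -> \bar R}).

Lemma integral_dist (F1 F2 g : T -> R) (c : R) :
  measurable_fun setT F1 -> m.-integrable setT (EFin \o F2) ->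
  measurable_fun setT g -> (\int[m]_x (g x)%:E <= c%:E)%E ->
  (forall x, `|F1 x - F2 x| <= g x) ->
  [/\ m.-integrable setT (EFin \o F1),
      `|fine (\int[m]_x (F1 x)%:E) - fine (\int[m]_x (F2 x)%:E)| <= c &
      (`|\int[m]_x (F1 x)%:E - \int[m]_x (F2 x)%:E| <= c%:E)%E].
Proof.
move=> mF1 iF2 mg gc F12.
have g0 x : 0 <= g x by rewrite (le_trans _ (F12 x)).
have ig : m.-integrable setT (EFin \o g).
  apply/integrableP; split; first exact/measurable_EFinP.
  under eq_integral do rewrite /= ger0_norm//.
  by rewrite (le_lt_trans gc)// ltry.
have mF2 := measurable_int _ iF2.
have mF12 : measurable_fun setT (fun x => F1 x - F2 x).
  by apply: measurable_funB => //; exact/measurable_EFinP.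
have iF12 : m.-integrable setT (EFin \o (fun x => F1 x - F2 x)).
  apply: le_integrable ig => //; first exact/measurable_EFinP.
  by move=> x _; rewrite /= lee_fin (ger0_norm (g0 x)).
have iF1 : m.-integrable setT (EFin \o F1).
  rewrite (_ : EFin \o F1 = (EFin \o (fun x => F1 x - F2 x)%R \+ (EFin \o F2))%E).
    exact: integrableD.
  by apply/funext => x /=; rewrite -EFinD subrK.
have H : (`|\int[m]_x (F1 x)%:E - \int[m]_x (F2 x)%:E| <= c%:E)%E.
  rewrite -integralB//; apply: le_trans gc.
  apply: le_trans (le_abse_integral _ _ _) _ => //.
    exact: measurable_int (iF12).
  apply: ge0_le_integral => //.
  - by apply: measurableT_comp => //; exact: measurable_int iF12.
  - exact/measurable_EFinP.
  - by move=> x _; rewrite /= lee_fin.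
split=> //; have := H.
by rewrite -{1}(fineK (integrable_fin_num _ iF1))// -{1}(fineK (integrable_fin_num _ iF2)).
Qed.

Lemma probability_mean_close (P : probability T R) (f : T -> R) (c xi : R) :
  measurable_fun setT f -> (forall x, `|f x - c| <= xi) ->
  `|fine (\int[P]_x (f x)%:E) - c| <= xi.
Proof.
move=> mf fc.
have cE k : (\int[P]_x (k%:E) = k%:E)%E.
  by rewrite integral_cst//= probability_setT mule1.
pose iP := finite_measure_integrable_cst P.
have b1 x : c - xi <= f x by have := fc x; rewrite ler_distl => /andP[].
have b2 x : f x <= c + xi by have := fc x; rewrite ler_distl => /andP[].
have if_ : P.-integrable setT (EFin \o f).
  apply: (@le_integrable _ _ _ P setT _ _ (EFin \o cst (`|c| + xi))) => //.
  - exact/measurable_EFinP.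
  - move=> x _; rewrite /= lee_fin; apply: le_trans (ler_norm _).
    by rewrite -(subrK c (f x)) (le_trans (ler_normD _ _))// addrC lerD2l.
  - exact: iP.
have fin := integrable_fin_num measurableT if_.
rewrite ler_distl; apply/andP; split; rewrite -lee_fin fineK// -(cE _).
  by apply: le_integral => //; [exact: iP|move=> x _; rewrite lee_fin].
by apply: le_integral => //; [exact: iP|move=> x _; rewrite lee_fin].
Qed.

End integral_comparison.

(** * Perturbation of a Gaussian *)

Section gaussian_perturbation.
Context {R : realType}.

Lemma expR_dist (e D : R) :
  `|expR (- (e + D)) - expR (- e)| <= `|D| * expR (`|D| - e).
Proof.
have -> : expR (- (e + D)) - expR (- e) = expR (- e) * (expR (- D) - 1).
  by rewrite opprD expRD mulrBr mulr1.
rewrite normrM ger0_norm ?expR_ge0// [`|D| - e]addrC expRD mulrCA ler_wpM2l ?expR_ge0//.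
have h1 := expR_ge1Dx (- D); have h2 := expR_ge1Dx D.
have h3 := expRN D; have h4 := expR_gt0 D; have h5 := expR_gt0 (- D).
have h6 : expR D * expR (- D) = 1 by rewrite -expRD subrr expR0.
have [D0|D0] := lerP 0 D.
  have e1 : 1 <= expR D by rewrite -expR0 ler_expR.
  have e2 : expR (- D) <= 1 by rewrite -expR0 ler_expR oppr_le0.
  rewrite ler0_norm ?subr_le0// (ger0_norm D0).
  have : 0 <= D * (expR D - 1) by rewrite mulr_ge0 ?subr_ge0.
  by lra.
have e1 : 1 <= expR (- D) by rewrite -expR0 ler_expR oppr_ge0 ltW.
rewrite ger0_norm ?subr_ge0// (ltr0_norm D0).
have : 0 <= - D * (1 - expR D) * expR (- D).
  rewrite !mulr_ge0 ?expR_ge0 ?oppr_ge0 ?subr_ge0 ?(ltW D0)//.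
  by rewrite -expR0 ler_expR ltW.
by nra.
Qed.

(** The cross term is bounded by [rho * (nsq x + M)], by Cauchy-Schwarz and the
    inequality of the two means. *)
Lemma nsq_sub_dist n (x dl : 'cV[R]_n) (rho M : R) : 0 <= rho <= 1 -> 0 <= M ->
  nsq dl <= rho ^+ 2 * M -> `|nsq (x - dl) - nsq x| <= rho * (nsq x + 2 * M).
Proof.
move=> /andP[r0 r1] M0 dM; pose c := \sum_i x i ord0 * dl i ord0.
have E : nsq (x - dl) - nsq x = nsq dl - 2 * c.
  rewrite /nsq /c mulr_sumr -!sumrB; apply: eq_bigr => i _; rewrite !mxE; ring.
have X0 := nsq_ge0 x; have D0 := nsq_ge0 dl.
have cc : `|2 * c| <= rho * (nsq x + M).
  rewrite -ler_sqr ?nnegrE ?mulr_ge0 ?addr_ge0// real_normK ?num_real// exprMn.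
  have := cauchy_schwarz_sum (fun i => x i ord0) (fun i => dl i ord0).
  rewrite -/c -/(nsq x) -/(nsq dl) => cs.
  have : nsq x * nsq dl <= nsq x * (rho ^+ 2 * M) by rewrite ler_wpM2l.
  have := mulr_ge0 (sqr_ge0 rho) (sqr_ge0 (nsq x - M)).
  by rewrite exprMn; nra.
rewrite E (le_trans (ler_normB _ _))// (ger0_norm D0).
have : rho ^+ 2 * M <= rho * M by rewrite ler_wpM2r// expr2 ler_piMr.
by nra.
Qed.

(** Moving the centre of a Gaussian by a relative amount [rho] changes the
    exponent by at most [rho] times a quadratic, which a slightly wider Gaussian
    absorbs. *)
Lemma gauss_perturb n k (x dl : 'cV[R]_n) (z ep : 'cV[R]_k) (rho : R) :
  0 <= rho -> 16 * rho <= 1 ->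
  nsq dl <= rho ^+ 2 * (1 + nsq z) -> nsq ep <= rho ^+ 2 ->
  `|expR (- 2^-1 * nsq (x - dl)) * expR (- 2^-1 * nsq (z - ep)) -
    expR (- 2^-1 * (nsq x + nsq z))| <=
  16 * expR 4^-1 * rho * expR (- 4^-1 * (nsq x + nsq z)).
Proof.
move=> r0 r16 dlM epM.
have X0 := nsq_ge0 x; have Z0 := nsq_ge0 z.
have r1 : 0 <= rho <= 1 by apply/andP; split; lra.
have h1 := nsq_sub_dist x r1 (_ : 0 <= 1 + nsq z) dlM.
have h2 := nsq_sub_dist z r1 ler01 (_ : nsq ep <= rho ^+ 2 * 1).
have {}h1 := h1 (addr_ge0 ler01 Z0).
have {}h2 := h2 (_ : _); rewrite mulr1 in h2; have {}h2 := h2 epM.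
set s := nsq x + nsq z.
pose D := 2^-1 * ((nsq (x - dl) - nsq x) + (nsq (z - ep) - nsq z)).
have DE : expR (- 2^-1 * nsq (x - dl)) * expR (- 2^-1 * nsq (z - ep)) =
    expR (- (2^-1 * s + D)).
  by rewrite -expRD; congr expR; rewrite /D /s; ring.
have Db : `|D| <= 2 * rho * (1 + s).
  rewrite /D normrM (ger0_norm (_ : 0 <= 2^-1 :> R))//.
  have := ler_normD (nsq (x - dl) - nsq x) (nsq (z - ep) - nsq z).
  by rewrite /s; nra.
have s0 : 0 <= s by exact: addr_ge0.
have Db' : `|D| <= 8^-1 * (1 + s) by rewrite (le_trans Db)//; nra.
rewrite DE (_ : - 2^-1 * s = - (2^-1 * s)); last by ring.
apply: le_trans (expR_dist _ _) _.
have e1 : 1 + s <= 8 * expR (8^-1 * (1 + s)).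
  by have := expR_ge1Dx (8^-1 * (1 + s)); lra.
have e2 : expR (`|D| - 2^-1 * s) <= expR (8^-1 * (1 + s) - 2^-1 * s).
  by rewrite ler_expR lerD2r.
apply: (@le_trans _ _ (2 * rho * (8 * expR (8^-1 * (1 + s))) *
    expR (8^-1 * (1 + s) - 2^-1 * s))).
  apply: ler_pM; rewrite ?expR_ge0 ?normr_ge0//.
  by apply: (le_trans Db); rewrite ler_wpM2l// mulr_ge0.
rewrite -mulrA -(mulrA 8) -expRD (_ : 16 * expR 4^-1 * rho * expR (- 4^-1 * s) =
  2 * rho * (8 * (expR 4^-1 * expR (- 4^-1 * s)))); last by ring.
rewrite -expRD le_eqVlt; apply/orP; left; apply/eqP.
by congr (_ * (_ * expR _)); field.
Qed.

End gaussian_perturbation.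

(** * The limiting joint law *)

Section reference_law.
Context {R : realType} (d K : nat).
Variables (Sigma : 'M[R]_d) (Gamma : 'M[R]_K) (a : 'cV[R]_d) (b : 'cV[R]_K).
Hypotheses (PS : posdefmx Sigma) (PG : posdefmx Gamma).

Local Notation A := (sqrtmx (invmx Sigma)).
Local Notation B := (sqrtmx (invmx Gamma)).
Local Notation lam := (leb R d \x leb R K)%E.

Definition quadU (u : 'cV[R]_d) : R := nsq (A *m (u - a)).
Definition quadY (y : 'cV[R]_K) : R := nsq (B *m (y - b)).

Definition refU u := gauss_factor Sigma * expR (- 2^-1 * quadU u).
Definition refY y := gauss_factor Gamma * expR (- 2^-1 * quadY y).
Definition ref (z : 'cV[R]_d * 'cV[R]_K) := refU z.1 * refY z.2.

(** Larger exponents mean faster decay; a negative one describes the growth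
    allowed for test functions. *)
Definition weight c (z : 'cV[R]_d * 'cV[R]_K) : R :=
  expR (- c * (quadU z.1 + quadY z.2)).

Lemma quadU_ge0 u : 0 <= quadU u. Proof. exact: nsq_ge0. Qed.

Lemma quadY_ge0 y : 0 <= quadY y. Proof. exact: nsq_ge0. Qed.

Lemma refU_gt0 u : 0 < refU u.
Proof. by rewrite mulr_gt0 ?expR_gt0 ?gauss_factor_gt0. Qed.

Lemma measurable_quadU : measurable_fun setT quadU.
Proof. by apply: measurable_nsq; apply: measurable_mxM; exact: measurable_mxB. Qed.

Lemma measurable_quadY : measurable_fun setT quadY.
Proof. by apply: measurable_nsq; apply: measurable_mxM; exact: measurable_mxB. Qed.

Lemma measurable_refU : measurable_fun setT refU.
Proof.
apply: measurable_funM => //; apply: measurableT_comp => //.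
by apply: measurable_funM => //; exact: measurable_quadU.
Qed.

Lemma measurable_refY : measurable_fun setT refY.
Proof.
apply: measurable_funM => //; apply: measurableT_comp => //.
by apply: measurable_funM => //; exact: measurable_quadY.
Qed.

Lemma measurable_ref : measurable_fun setT ref.
Proof.
apply: measurable_funM.
  exact: measurableT_comp measurable_refU measurable_fst.
exact: measurableT_comp measurable_refY measurable_snd.
Qed.

Lemma measurable_weight c : measurable_fun setT (weight c).
Proof.
apply: measurableT_comp => //; apply: measurable_funM => //; apply: measurable_funD.
  exact: measurableT_comp measurable_quadU measurable_fst.
exact: measurableT_comp measurable_quadY measurable_snd.
Qed.

Lemma integral_refU : (\int[leb R d]_u (refU u)%:E = 1)%E.
Proof.
rewrite -(gaussian_density_integral a PS); apply: eq_integral => u _.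
by rewrite wnorm_sqr.
Qed.

Lemma integral_refY : (\int[leb R K]_y (refY y)%:E = 1)%E.
Proof.
rewrite -(gaussian_density_integral b PG); apply: eq_integral => y _.
by rewrite wnorm_sqr.
Qed.

Lemma integral_weightU_lty c : 0 < c ->
  (\int[leb R d]_u (expR (- c * quadU u))%:E < +oo)%E.
Proof. by move=> c0; apply: integral_expR_nsq_lty => //; exact: posdef_inv. Qed.

Lemma integral_weight_lty c : 0 < c -> (\int[lam]_z (weight c z)%:E < +oo)%E.
Proof.
move=> c0; have mwE : measurable_fun setT (fun z => (weight c z)%:E).
  by apply/measurable_EFinP; exact: measurable_weight.
rewrite fubini_tonelli1//=; last by move=> z; rewrite lee_fin expR_ge0.
rewrite /fubini_F.
have mU : measurable_fun setT (fun u => (expR (- c * quadU u))%:E).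
  apply/measurable_EFinP; apply: measurableT_comp => //.
  by apply: measurable_funM => //; exact: measurable_quadU.
have mY : measurable_fun setT (fun y => (expR (- c * quadY y))%:E).
  apply/measurable_EFinP; apply: measurableT_comp => //.
  by apply: measurable_funM => //; exact: measurable_quadY.
under eq_integral => u _.
  under eq_integral => y _ do rewrite /weight/= mulrDr expRD EFinM.
  rewrite ge0_integralZl//=.
  over.
have Y0 : (0 <= \int[leb R K]_y (expR (- c * quadY y))%:E)%E.
  by apply: integral_ge0 => y _; rewrite lee_fin expR_ge0.
rewrite ge0_integralZr//=.
apply: lte_mul_pinfty.
- by apply: integral_ge0 => y _; rewrite lee_fin expR_ge0.
- rewrite ge0_fin_numE; first exact: integral_weightU_lty.
  by apply: integral_ge0 => y _; rewrite lee_fin expR_ge0.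
- by apply: integral_expR_nsq_lty => //; exact: posdef_inv.
Qed.

Lemma refE z : ref z = gauss_factor Sigma * gauss_factor Gamma * weight 2^-1 z.
Proof. by rewrite /ref /refU /refY /weight mulrDr expRD; ring. Qed.

Lemma quad_coercive : exists2 c, 0 < c &
  (forall u, 1 + nsq u <= c * (1 + quadU u)) /\
  (forall y, 1 + nsq y <= c * (1 + quadY y)).
Proof.
have [c1 c10 H1] := nsq_sqrtmx_coercive (posdef_inv PS).
have [c2 c20 H2] := nsq_sqrtmx_coercive (posdef_inv PG).
have a0 := nsq_ge0 a; have b0 := nsq_ge0 b.
exists (1 + 2 * nsq a + 2 * nsq b + 2 * c1 + 2 * c2); first by nra.
split=> [u|y].
  have := nsqD_le (u - a) a; rewrite subrK; have := H1 (u - a).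
  by rewrite -/(quadU u); have := quadU_ge0 u; nra.
have := nsqD_le (y - b) b; rewrite subrK; have := H2 (y - b).
by rewrite -/(quadY y); have := quadY_ge0 y; nra.
Qed.

(** Quadratic growth in each variable costs only a little of the Gaussian
    decay. *)
Lemma growth_le_weight : exists2 M, 0 < M &
  forall z, (1 + nsq z.1) * (1 + nsq z.2) <= M * weight (- 8^-1) z.
Proof.
have [c c0 [HU HY]] := quad_coercive.
have e8 (s : R) : 1 + s <= 8 * expR (8^-1 * (1 + s)).
  by have := expR_ge1Dx (8^-1 * (1 + s)); lra.
exists ((c * (8 * expR 8^-1)) * (c * (8 * expR 8^-1))) => [|z].
  by rewrite !mulr_gt0 ?expR_gt0.
have h (n s : R) : 0 <= n -> 1 + n <= c * (1 + s) ->
    1 + n <= c * (8 * expR 8^-1) * expR (8^-1 * s).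
  move=> n0 /le_trans; apply; rewrite -!mulrA ler_pM2l// -expRD.
  by rewrite (le_trans (e8 s))// mulrDr mulr1.
have := ler_pM _ _ (h _ _ (nsq_ge0 z.1) (HU z.1))
  (h _ _ (nsq_ge0 z.2) (HY z.2)).
rewrite !addr_ge0 ?nsq_ge0// => /(_ isT isT)/le_trans; apply.
by rewrite /weight opprK mulrDr expRD le_eqVlt; apply/orP; left; apply/eqP; ring.
Qed.

End reference_law.

(** * The joint density of state and observation *)

Section joint_density.
Context {R : realType} (d K : nat).
Variables (Sigma : 'M[R]_d) (Gamma : 'M[R]_K).
Hypotheses (PS : posdefmx Sigma) (PG : posdefmx Gamma).
Variables (Psi : 'cV[R]_d -> 'cV[R]_d) (h : 'cV[R]_d -> 'cV[R]_K).
Hypotheses (mPsi : measurable_fun setT Psi) (mh : measurable_fun setT h).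
Variable mu : probability 'cV[R]_d R.

Local Notation lam := (leb R d \x leb R K)%E.
Local Notation q := (QP_density Sigma Gamma Psi h mu).

Let kern (z : 'cV[R]_d * 'cV[R]_d) : R :=
  gauss_factor Sigma * expR (- 2^-1 * wnorm Sigma (z.1 - Psi z.2) ^+ 2).

Let mkern : measurable_fun setT kern.
Proof.
rewrite /kern; under eq_fun do rewrite wnorm_sqr.
apply: measurable_funM => //; apply: measurable_expR_nsq.
by apply: measurable_mxB => //; exact: measurableT_comp mPsi measurable_snd.
Qed.

Let kern_ge0 z : 0 <= kern z.
Proof. by rewrite mulr_ge0 ?expR_ge0// ltW// gauss_factor_gt0. Qed.

Lemma P_densityE u :
  ((P_density Sigma Psi mu u)%:E = \int[mu]_v (kern (u, v))%:E)%E.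
Proof.
have mg : measurable_fun setT
    (fun v => expR (- 2^-1 * wnorm Sigma (u - Psi v) ^+ 2)).
  under eq_fun do rewrite wnorm_sqr.
  by apply: measurable_expR_nsq; exact: measurable_mxB.
have ig : mu.-integrable setT
    (EFin \o (fun v => expR (- 2^-1 * wnorm Sigma (u - Psi v) ^+ 2))).
  apply: (@le_integrable _ _ _ mu setT _ _ (EFin \o cst 1)) => //.
  - exact/measurable_EFinP.
  - move=> v _; rewrite /= lee_fin normr1 ger0_norm ?expR_ge0//.
    by rewrite -expR0 ler_expR mulNr oppr_le0 mulr_ge0 ?sqr_ge0.
  - exact: finite_measure_integrable_cst.
rewrite /P_density EFinM fineK; last exact: integrable_fin_num.
by under [RHS]eq_integral do rewrite EFinM; rewrite integralZl.
Qed.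

Lemma measurable_P_density : measurable_fun setT (P_density Sigma Psi mu).
Proof.
apply/measurable_EFinP; rewrite (_ : EFin \o _ = fubini_F mu (EFin \o kern)).
  apply: measurable_fun_fubini_tonelli_F; first exact/measurable_EFinP.
  by move=> z; rewrite lee_fin.
by apply/funext => u; rewrite /= P_densityE.
Qed.

Lemma P_density_ge0 u : 0 <= P_density Sigma Psi mu u.
Proof.
by rewrite -lee_fin P_densityE; apply: integral_ge0 => v _; rewrite lee_fin.
Qed.

Lemma integral_P_density : (\int[leb R d]_u (P_density Sigma Psi mu u)%:E = 1)%E.
Proof.
under eq_integral do rewrite P_densityE.
rewrite (@fubini_tonelli _ _ _ _ _ (leb R d) mu (EFin \o kern)); last 2 first.
- exact/measurable_EFinP.
- by move=> z; rewrite lee_fin.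
transitivity (\int[mu]_v 1)%E.
  by apply: eq_integral => v _; exact: (gaussian_density_integral (Psi v) PS).
by rewrite integral_cst//= mul1e probability_setT.
Qed.

Lemma measurable_QP : measurable_fun setT q.
Proof.
rewrite /QP_density /Q_density; under eq_fun do rewrite wnorm_sqr.
apply: measurable_funM.
  2: exact: measurableT_comp measurable_P_density measurable_fst.
apply: measurable_funM => //; apply: measurable_expR_nsq.
by apply: measurable_mxB => //; exact: measurableT_comp mh measurable_fst.
Qed.

Lemma QP_ge0 z : 0 <= q z.
Proof.
apply: mulr_ge0; last exact: P_density_ge0.
by rewrite mulr_ge0 ?expR_ge0// ltW// gauss_factor_gt0.
Qed.

Lemma integral_QP : (\int[lam]_z (q z)%:E = 1)%E.
Proof.
rewrite fubini_tonelli1//=; last 2 first.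
- by apply/measurable_EFinP; exact: measurable_QP.
- by move=> z; rewrite lee_fin QP_ge0.
rewrite /fubini_F -integral_P_density; apply: eq_integral => u _.
under eq_integral do rewrite /QP_density /Q_density /= EFinM.
rewrite ge0_integralZr//=.
- by rewrite (gaussian_density_integral (h u) PG) mul1e.
- apply/measurable_EFinP; under eq_fun do rewrite wnorm_sqr.
  apply: measurable_funM => //; apply: measurable_expR_nsq.
  exact: measurable_mxB.
- by move=> y _; rewrite lee_fin mulr_ge0 ?expR_ge0// ltW// gauss_factor_gt0.
- by rewrite lee_fin P_density_ge0.
Qed.

End joint_density.

Section joint_density_close.
Context {R : realType} (d K : nat).
Variables (Sigma : 'M[R]_d) (Gamma : 'M[R]_K) (a : 'cV[R]_d) (b : 'cV[R]_K).
Hypotheses (PS : posdefmx Sigma) (PG : posdefmx Gamma).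

Local Notation A := (sqrtmx (invmx Sigma)).
Local Notation B := (sqrtmx (invmx Gamma)).

Definition close (rho : R) (q : 'cV[R]_d * 'cV[R]_K -> R) :=
  forall z, `|q z - ref Sigma Gamma a b z| <= rho * weight Sigma Gamma a b 4^-1 z.

(** The displacement [s] accounts for the Kalman update, which moves a point by
    an amount growing linearly with [y].  The bound is uniform in [mu], since
    [Psi v] is near [a] for every [v]: this is why earlier steps are forgotten. *)
Lemma QP_close : exists C r0 : R, [/\ 0 < C, 0 < r0 &
  forall (mu : probability 'cV[R]_d R) (Psi : 'cV[R]_d -> 'cV[R]_d)
    (h : 'cV[R]_d -> 'cV[R]_K) (s : 'cV[R]_K -> 'cV[R]_d) (r : R),
    0 <= r <= r0 -> measurable_fun setT Psi ->
    (forall u, nsq (Psi u - a) <= r ^+ 2) ->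
    (forall u, nsq (h u - b) <= r ^+ 2) ->
    (forall y, nsq (s y) <= r ^+ 2 * (1 + nsq (y - b))) ->
    close (C * r) (fun z => QP_density Sigma Gamma Psi h mu (z.1 - s z.2, z.2))].
Proof.
have [k k0 Hk] := nsq_sqrtmx_coercive (posdef_inv PG).
have A0 := fnorm2_ge0 A; have B0 := fnorm2_ge0 B.
(* [c] bounds the effect of [A], [B] and of the change from [y - b] to
   [B *m (y - b)] on squared norms; being at least 1 it is below its square. *)
set c := 4 * fnorm2 A * (1 + k) + fnorm2 B + 1.
have c1 : 1 <= c by rewrite /c; nra.
have gS0 := gauss_factor_gt0 PS; have gG0 := gauss_factor_gt0 PG.
exists (gauss_factor Sigma * gauss_factor Gamma * (16 * expR 4^-1) * c).
exists (16 * c)^-1.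
split; [by rewrite !mulr_gt0 ?expR_gt0//; lra|by rewrite invr_gt0; lra|].
move=> mu Psi h s r /andP[r0 rc] mPsi HPsi Hh Hs [w y] /=.
rewrite refE /QP_density /Q_density /P_density !wnorm_sqr /=.
set x := A *m (w - a); set zz := B *m (y - b); set u := w - s y.
have Es v : A *m (u - Psi v) = x - A *m (s y + (Psi v - a)).
  by rewrite /x -mulmxBr; congr (_ *m _); apply/colP => i; rewrite /u !mxE; ring.
have Ey : B *m (y - h u) = zz - B *m (h u - b).
  by rewrite /zz -mulmxBr; congr (_ *m _); apply/colP => i; rewrite !mxE; ring.
have cr0 : 0 <= c * r by rewrite mulr_ge0//; lra.
have cr : 16 * (c * r) <= 1.
  by move: rc; rewrite -[leRHS]mul1r ler_pdivlMr; lra.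
have r20 := sqr_ge0 r.
have Ybound : nsq (y - b) <= k * nsq zz by exact: Hk.
have Z0 := nsq_ge0 zz.
have d1 v : nsq (A *m (s y + (Psi v - a))) <= (c * r) ^+ 2 * (1 + nsq zz).
  apply: le_trans (nsq_mulmx_le _ _) _.
  have h1 := nsqD_le (s y) (Psi v - a); have h2 := HPsi v; have h3 := Hs y.
  have h4 : nsq (s y + (Psi v - a)) <= 4 * (1 + k) * (1 + nsq zz) * r ^+ 2.
    apply: (le_trans h1).
    have : r ^+ 2 * nsq (y - b) <= r ^+ 2 * (k * nsq zz) by rewrite ler_wpM2l.
    have : 0 <= r ^+ 2 * nsq zz by rewrite mulr_ge0.
    have : 0 <= r ^+ 2 * k by rewrite mulr_ge0// ltW.
    have : 0 <= r ^+ 2 * (k * nsq zz) by rewrite !mulr_ge0// ltW.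
    by nra.
  have := ler_wpM2l A0 h4; move=> /le_trans; apply.
  rewrite exprMn [leRHS](_ : _ = c ^+ 2 * ((1 + nsq zz) * r ^+ 2)); last by ring.
  rewrite [leLHS](_ : _ = (4 * fnorm2 A * (1 + k)) * ((1 + nsq zz) * r ^+ 2));
    last by ring.
  rewrite ler_wpM2r//; first by rewrite mulr_ge0// addr_ge0.
  have cc : c <= c ^+ 2 by rewrite expr2 ler_peMl//; lra.
  by apply: le_trans cc; rewrite /c; lra.
have d2 : nsq (B *m (h u - b)) <= (c * r) ^+ 2.
  apply: le_trans (nsq_mulmx_le _ _) _; rewrite exprMn.
  apply: ler_pM => //; first exact: nsq_ge0.
  have cc : c <= c ^+ 2 by rewrite expr2 ler_peMl//; lra.
  by apply: le_trans cc; rewrite /c; nra.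
set e1 := expR (- 2^-1 * nsq (B *m (y - h u))).
have e10 : 0 < e1 by exact: expR_gt0.
pose f v := expR (- 2^-1 * wnorm Sigma (u - Psi v) ^+ 2).
set W := weight _ _ _ _ 4^-1 _; set W2 := weight _ _ _ _ 2^-1 _.
have mf : measurable_fun setT f.
  rewrite /f; under eq_fun do rewrite wnorm_sqr.
  by apply: measurable_expR_nsq; exact: measurable_mxB.
(* The factor [e1] is constant in [v] and is divided out before averaging. *)
have Hf v : `|f v - W2 / e1| <= (16 * expR 4^-1 * (c * r) * W) / e1.
  rewrite -(ler_pM2r e10) divfK ?gt_eqF// -{2}(gtr0_norm e10) -normrM.
  rewrite mulrBl divfK ?gt_eqF//.
  have := gauss_perturb x cr0 cr (d1 v) d2.
  by rewrite -Es -Ey /f wnorm_sqr /W /W2 /e1 /weight.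
have := probability_mean_close mu mf Hf; set I := fine _ => HI.
rewrite [X in `|X|](_ : _ =
  gauss_factor Sigma * gauss_factor Gamma * e1 * (I - W2 / e1)).
  rewrite normrM gtr0_norm ?mulr_gt0//.
  apply: le_trans (ler_wpM2l _ HI) _; first by rewrite !mulr_ge0// ltW.
  rewrite le_eqVlt; apply/orP; left; apply/eqP; rewrite -/W.
  by field; rewrite gt_eqF.
by field; rewrite gt_eqF.
Qed.

End joint_density_close.

(** * Moments of densities close to the limiting one *)

Section weighted_integral.
Context dd (T : measurableType dd) (R : realType) (m : {measure set T -> \bar R}).
Variable q : T -> R.

Definition wint (f : T -> R) : R := fine (\int[m]_x (f x * q x)%:E)%E.

Definition wintegrable (f : T -> R) :=
  m.-integrable setT (EFin \o (fun x => f x * q x)).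

Lemma wintD f g : wintegrable f -> wintegrable g ->
  wintegrable (fun x => f x + g x) /\ wint (fun x => f x + g x) = wint f + wint g.
Proof.
move=> If Ig; have E : (EFin \o (fun x => (f x + g x) * q x)) =
    ((EFin \o (fun x => f x * q x)%R) \+ (EFin \o (fun x => g x * q x)%R))%E.
  by apply/funext => x /=; rewrite mulrDl.
split; first by rewrite /wintegrable E; exact: integrableD.
rewrite /wint -fineD; try exact: integrable_fin_num.
by congr fine; rewrite -integralD//; apply: eq_integral => x _; rewrite mulrDl.
Qed.

Lemma wintZ c f : wintegrable f ->
  wintegrable (fun x => c * f x) /\ wint (fun x => c * f x) = c * wint f.
Proof.
move=> If; have E : (EFin \o (fun x => c * f x * q x)) =
    ((cst c%:E) \* (EFin \o (fun x => f x * q x)%R))%E.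
  by apply/funext => x /=; rewrite -EFinM mulrA.
split; first by rewrite /wintegrable E; exact: integrableZl.
rewrite /wint; under eq_integral do rewrite -mulrA EFinM.
by rewrite integralZl// fineM//; exact: integrable_fin_num If.
Qed.

Lemma wint_sum (I : finType) (f : I -> T -> R) : (forall i, wintegrable (f i)) ->
  wintegrable (fun x => \sum_i f i x) /\
  wint (fun x => \sum_i f i x) = \sum_i wint (f i).
Proof.
move=> If; elim: (index_enum I) => [|i s [IH1 IH2]].
  under eq_fun do rewrite big_nil; rewrite big_nil.
  rewrite /wintegrable /wint; under eq_fun do rewrite mul0r.
  split; first exact: integrable0.
  by rewrite integral0_eq// => x _; rewrite mul0r.
under eq_fun do rewrite big_cons; rewrite big_cons -IH2.
exact: wintD.
Qed.

Lemma wint_cov f g : wintegrable (cst 1) -> wint (cst 1) = 1 ->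
  wintegrable f -> wintegrable g -> wintegrable (fun x => f x * g x) ->
  wintegrable (fun x => (f x - wint f) * (g x - wint g)) /\
  wint (fun x => (f x - wint f) * (g x - wint g)) =
  wint (fun x => f x * g x) - wint f * wint g.
Proof.
move=> I1 E1 If Ig Ifg; set s := wint f; set t := wint g.
have E : (fun x => (f x - s) * (g x - t)) =
    (fun x => (f x * g x + (- s) * g x) + ((- t) * f x + (s * t) * cst 1 x)).
  by apply/funext => x /=; ring.
have [J1 K1] := wintZ (- s) Ig; have [J2 K2] := wintZ (- t) If.
have [J3 K3] := wintZ (s * t) I1.
have [J4 K4] := wintD Ifg J1; have [J5 K5] := wintD J2 J3.
have [J6 K6] := wintD J4 J5.
by split; rewrite E// K6 K4 K5 K1 K2 K3 E1 -/s -/t; ring.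
Qed.

End weighted_integral.

Section boxes.
Context {R : realType}.

(** Signs are chosen so that all the terms of the sum pull away from [t].  This
    bounds the variance of a linear form from below without knowing its mean. *)
Lemma unit_box_linear n (v : 'cV[R]_n) (t : R) : exists sg : 'I_n -> bool,
  forall y, unit_box sg y -> nsq v <= (\sum_i v i ord0 * y i ord0 - t) ^+ 2.
Proof.
have abs2 : nsq v <= (\sum_i `|v i ord0|) ^+ 2.
  rewrite expr2 mulr_suml; apply: ler_sum => i _.
  rewrite -(real_normK (num_real (v i ord0))) expr2 ler_wpM2l//.
  by rewrite (bigD1 i)//= lerDl sumr_ge0.
have s0 : 0 <= \sum_i `|v i ord0| by apply: sumr_ge0.
have [t0|t0] := ltP 0 t.
  exists (fun i => 0 < v i ord0) => y Hy; apply: (le_trans abs2).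
  have : \sum_i v i ord0 * y i ord0 <= - \sum_i `|v i ord0|.
    rewrite -sumrN; apply: ler_sum => i _; have := Hy i.
    case: (ltP 0 (v i ord0)) => vi /=;
      rewrite ?expr0 ?expr1 ?mul1r ?mulN1r => /andP[? ?].
      by rewrite gtr0_norm//; nra.
    by rewrite ler0_norm//; nra.
  by nra.
exists (fun i => v i ord0 < 0) => y Hy; apply: (le_trans abs2).
have : \sum_i `|v i ord0| <= \sum_i v i ord0 * y i ord0.
  apply: ler_sum => i _; have := Hy i.
  case: (ltP (v i ord0) 0) => vi /=;
    rewrite ?expr0 ?expr1 ?mul1r ?mulN1r => /andP[? ?].
    by rewrite ltr0_norm//; nra.
  by rewrite ger0_norm//; nra.
by nra.
Qed.

Lemma unit_box_nsq n (sg : 'I_n -> bool) (y : 'cV[R]_n) :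
  unit_box sg y -> nsq y <= 4 * n%:R.
Proof.
move=> Hy; rewrite /nsq (le_trans (_ : _ <= \sum_(i < n) (4 : R)))//; last first.
  by rewrite sumr_const card_ord mulr_natr.
apply: ler_sum => i _; have := Hy i.
by case: (sg i); rewrite ?expr0 ?expr1 ?mul1r ?mulN1r => /andP[? ?]; nra.
Qed.

End boxes.

Section moments.
Context {R : realType} (d K : nat).
Variables (Sigma : 'M[R]_d) (Gamma : 'M[R]_K) (a : 'cV[R]_d) (b : 'cV[R]_K).
Hypotheses (PS : posdefmx Sigma) (PG : posdefmx Gamma).

Local Notation T := ('cV[R]_d * 'cV[R]_K)%type.
Local Notation lam := (leb R d \x leb R K)%E.
Local Notation ref := (ref Sigma Gamma a b).
Local Notation weight := (weight Sigma Gamma a b).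
Local Notation close := (close Sigma Gamma a b).

Definition growth (z : T) : R := (1 + nsq z.1) * (1 + nsq z.2).

Lemma growth_ge1 z : 1 <= growth z.
Proof.
have := nsq_ge0 z.1; have := nsq_ge0 z.2; rewrite /growth => ? ?.
by rewrite -[leLHS]mulr1 ler_pM// lerDl.
Qed.

(** The growth of [f] costs an exponent 1/8, the error has exponent 1/4, and the
    remaining weight of exponent 1/8 is integrable. *)
Lemma moment_close : exists2 C, 0 < C & forall rho c q (f : T -> R),
  0 <= rho -> 0 <= c -> measurable_fun setT q -> close rho q ->
  measurable_fun setT f -> (forall z, `|f z| <= c * growth z) ->
  [/\ wintegrable lam q f, wintegrable lam ref f,
      `|wint lam ref f| <= c * C, `|wint lam q f - wint lam ref f| <= c * C * rho &
      (`|\int[lam]_z (f z * q z)%:E - \int[lam]_z (f z * ref z)%:E| <=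
        (c * C * rho)%:E)%E].
Proof.
have [M M0 HM] := growth_le_weight a b PS PG.
have w8 : (\int[lam]_z (weight 8^-1 z)%:E < +oo)%E by exact: integral_weight_lty.
have w80 : (0 <= \int[lam]_z (weight 8^-1 z)%:E)%E.
  by apply: integral_ge0 => z _; rewrite lee_fin expR_ge0.
have gS0 := gauss_factor_gt0 PS; have gG0 := gauss_factor_gt0 PG.
set gg := gauss_factor Sigma * gauss_factor Gamma + 1.
set w := fine (\int[lam]_z (weight 8^-1 z)%:E)%E.
have w0 : 0 <= w by exact: fine_ge0.
have gg1 : 1 <= gg by rewrite lerDr mulr_ge0 ?ltW.
have mw := measurable_weight Sigma Gamma a b.
have bnd (k : R) : 0 <= k ->
    (\int[lam]_z (k * M * weight 8^-1 z)%:E <= (k * (M * (w + 1)))%:E)%E.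
  move=> k0; under eq_integral do rewrite EFinM.
  rewrite ge0_integralZl//=.
  - rewrite -[X in (_ * X)%E]fineK ?ge0_fin_numE// -EFinM lee_fin -/w -mulrA.
    by rewrite ler_wpM2l// ler_wpM2l ?ltW// ltrDl.
  - by apply/measurable_EFinP; exact: mw.
  - by move=> z _; rewrite lee_fin expR_ge0.
  - by rewrite lee_fin mulr_ge0// ltW.
have ww z c e : c + 8^-1 <= e -> weight (- 8^-1) z * weight e z <= weight c z.
  move=> ce; rewrite /weight -expRD ler_expR -mulrDl ler_wpM2r ?addr_ge0 ?nsq_ge0//.
  by lra.
exists (gg * (M * (w + 1))) => [|rho c q f rho0 c0 mq cq mf fc].
  by rewrite !mulr_gt0//; lra.
have mref := measurable_ref Sigma Gamma a b.
have mfr : measurable_fun setT (fun z => f z * ref z) by exact: measurable_funM.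
have mfq : measurable_fun setT (fun z => f z * q z) by exact: measurable_funM.
have fM z : `|f z| <= c * M * weight (- 8^-1) z.
  by apply: (le_trans (fc z)); rewrite -mulrA ler_wpM2l// HM.
have bz z e : 8^-1 + 8^-1 <= e ->
    c * M * weight (- 8^-1) z * weight e z <= c * M * weight 8^-1 z.
  by move=> e4; rewrite -mulrA ler_wpM2l ?ww// mulr_ge0// ltW.
have Hr z : `|f z * ref z - cst 0 z| <= c * gg * M * weight 8^-1 z.
  rewrite /= subr0 normrM refE; set W := weight 2^-1 z.
  have W0 : 0 <= W by exact: expR_ge0.
  have gle : `|gauss_factor Sigma * gauss_factor Gamma * W| <= gg * W.
    by rewrite ger0_norm ?mulr_ge0 ?(ltW gS0) ?(ltW gG0)// ler_wpM2r// lerDl.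
  apply: le_trans (ler_pM _ _ (fM z) gle) _ => //.
  rewrite [leLHS](_ : _ = gg * (c * M * weight (- 8^-1) z * W)); last by ring.
  rewrite [leRHS](_ : _ = gg * (c * M * weight 8^-1 z)); last by ring.
  by rewrite ler_wpM2l//; [lra|apply: bz; lra].
have Hq z : `|f z * q z - f z * ref z| <= c * rho * gg * M * weight 8^-1 z.
  rewrite -mulrBr normrM; apply: le_trans (ler_pM _ _ (fM z) (cq z)) _ => //.
  rewrite mulrCA [leRHS](_ : _ = rho * (gg * (c * M * weight 8^-1 z))); last by ring.
  rewrite ler_wpM2l//; apply: le_trans (bz z 4^-1 _) _; first by lra.
  by rewrite ler_peMl// !mulr_ge0 ?expR_ge0// ltW.
have mkw k : measurable_fun setT (fun z => k * weight 8^-1 z).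
  by apply: measurable_funM => //; exact: mw.
have c1 : 0 <= c * gg by rewrite mulr_ge0//; lra.
have c2 : 0 <= c * rho * gg by rewrite !mulr_ge0//; lra.
have i0 : lam.-integrable setT (EFin \o cst 0) by exact: integrable0.
have [Ir Br _] := integral_dist mfr i0 (mkw _) (bnd _ c1) Hr.
have [Iq Bq Eq] := integral_dist mfq Ir (mkw _) (bnd _ c2) Hq.
split=> //.
- by move: Br; rewrite integral0 subr0 -mulrA.
- by rewrite (le_trans Bq)// le_eqVlt; apply/orP; left; apply/eqP; ring.
- rewrite (le_trans Eq)// lee_fin le_eqVlt; apply/orP; left; apply/eqP; ring.
Qed.

End moments.

(** * The Kalman gain *)

Section reference_product.
Context {R : realType}.

Lemma growthU n (S : 'M[R]_n) (m : 'cV[R]_n) : posdefmx S ->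
  exists2 M, 0 < M & forall u, 1 + nsq u <= M * expR (8^-1 * quadU S m u).
Proof.
move=> PS; have [M M0 HM] := growth_le_weight m m PS PS; exists M => // u.
have := HM (u, m); rewrite /weight opprK /= /quadY subrr mulmx0.
rewrite nsq0 addr0; apply: le_trans.
by rewrite ler_peMr ?addr_ge0 ?nsq_ge0// lerDl nsq_ge0.
Qed.

Lemma wintegrable_refU n (S : 'M[R]_n) (m : 'cV[R]_n) (f : 'cV[R]_n -> R) :
  posdefmx S -> measurable_fun setT f -> (forall u, `|f u| <= 1 + nsq u) ->
  wintegrable (leb R n) (refU S m) f.
Proof.
move=> PS mf fb; have [M M0 HM] := growthU m PS.
have gS0 := gauss_factor_gt0 PS.
have mq := measurable_quadU S m.
have fM u : `|f u| <= M * expR (8^-1 * quadU S m u) by exact: le_trans (HM u).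
pose g u := M * gauss_factor S * expR (- 8^-1 * quadU S m u).
have mg : measurable_fun setT g.
  apply: measurable_funM => //; apply: measurableT_comp => //.
  exact: measurable_funM.
have g0 u : 0 <= g u by rewrite !mulr_ge0 ?expR_ge0// ltW.
apply: (@le_integrable _ _ _ _ _ _ _ (EFin \o g)) => //.
- apply/measurable_EFinP; apply: measurable_funM => //.
  exact: measurable_refU.
- move=> u _; rewrite /= lee_fin (ger0_norm (g0 u)) normrM.
  rewrite (ger0_norm (ltW (refU_gt0 m PS u))).
  apply: le_trans (ler_wpM2r (ltW (refU_gt0 m PS u)) (fM u)) _.
  rewrite /g /refU; set Q := quadU _ _ _.
  rewrite [leLHS](_ : _ = M * gauss_factor S *
    (expR (8^-1 * Q) * expR (- 2^-1 * Q))); last by ring.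
  rewrite ler_wpM2l//; first by rewrite mulr_ge0// ltW.
  by rewrite -expRD ler_expR; have := quadU_ge0 S m u; rewrite -/Q; lra.
- apply/integrableP; split; first exact/measurable_EFinP.
  under eq_integral do rewrite /= ger0_norm// EFinM.
  rewrite ge0_integralZl//=.
  + apply: lte_mul_pinfty => //; first by rewrite lee_fin mulr_ge0// ltW.
    by apply: integral_weightU_lty.
  + apply/measurable_EFinP; apply: measurableT_comp => //.
    exact: measurable_funM.
  + by rewrite lee_fin mulr_ge0// ltW.
Qed.

Context (d K : nat).
Variables (Sigma : 'M[R]_d) (Gamma : 'M[R]_K) (a : 'cV[R]_d) (b : 'cV[R]_K).
Hypotheses (PS : posdefmx Sigma) (PG : posdefmx Gamma).

Local Notation lam := (leb R d \x leb R K)%E.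
Local Notation ref := (ref Sigma Gamma a b).

Lemma integral_ref_prod (f : 'cV[R]_d -> R) (g : 'cV[R]_K -> R) :
  measurable_fun setT f -> measurable_fun setT g ->
  (forall u, `|f u| <= 1 + nsq u) -> (forall y, `|g y| <= 1 + nsq y) ->
  (\int[lam]_z (f z.1 * g z.2 * ref z)%:E =
   (\int[leb R d]_u (f u * refU Sigma a u)%:E) *
   (\int[leb R K]_y (g y * refY Gamma b y)%:E))%E.
Proof.
move=> mf mg fb gb.
have If := wintegrable_refU a PS mf fb.
have Ig : wintegrable (leb R K) (refY Gamma b) g := wintegrable_refU b PG mg gb.
have [C C0 HC] := moment_close a b PS PG.
have mfg : measurable_fun setT (fun z : 'cV[R]_d * 'cV[R]_K => f z.1 * g z.2).
  apply: measurable_funM; first exact: measurableT_comp mf measurable_fst.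
  exact: measurableT_comp mg measurable_snd.
have [|z|_ Ifg _ _ _] := HC 0 1 ref _ (lexx 0) ler01
  (measurable_ref Sigma Gamma a b) _ mfg.
- by move=> z; rewrite subrr normr0 mul0r.
- by rewrite mul1r normrM ler_pM.
rewrite -(integral12_prod_meas1 Ifg) /fubini_F.
under eq_integral => u _.
  under eq_integral => y _ do
    rewrite /= (_ : ref (u, y) = refU Sigma a u * refY Gamma b y)//
      mulrACA EFinM.
  rewrite integralZl//.
  over.
have gE := fineK (integrable_fin_num measurableT Ig).
rewrite -[X in (_ * X)%E]gE -integralZr//.
by apply: eq_integral => u _; rewrite gE.
Qed.

(** Independence of state and observation under the limiting law: this is what
    makes the cross covariance vanish in the limit. *)
Lemma wint_ref_prod (f : 'cV[R]_d -> R) (g : 'cV[R]_K -> R) :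
  measurable_fun setT f -> measurable_fun setT g ->
  (forall u, `|f u| <= 1 + nsq u) -> (forall y, `|g y| <= 1 + nsq y) ->
  wint lam ref (fun z => f z.1 * g z.2) =
  wint lam ref (fun z => f z.1) * wint lam ref (fun z => g z.2).
Proof.
move=> mf mg fb gb.
have If := wintegrable_refU a PS mf fb.
have Ig : wintegrable (leb R K) (refY Gamma b) g := wintegrable_refU b PG mg gb.
have b1 n (u : 'cV[R]_n) : `|cst 1 u : R| <= 1 + nsq u.
  by rewrite /= normr1 lerDl nsq_ge0.
have E1 : (\int[leb R d]_u (cst 1%R u * refU Sigma a u)%:E = 1)%E.
  by rewrite -(integral_refU a PS); apply: eq_integral => u _; rewrite mul1r.
have E2 : (\int[leb R K]_y (cst 1%R y * refY Gamma b y)%:E = 1)%E.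
  by rewrite -(integral_refY b PG); apply: eq_integral => u _; rewrite mul1r.
have Ef : wint lam ref (fun z => f z.1) =
    fine (\int[leb R d]_u (f u * refU Sigma a u)%:E)%E.
  rewrite /wint -[X in _ = fine X]mule1 -E2 -integral_ref_prod//.
    2: exact: b1.
  by under [in RHS]eq_integral do rewrite /= mulr1.
have Eg : wint lam ref (fun z => g z.2) =
    fine (\int[leb R K]_y (g y * refY Gamma b y)%:E)%E.
  rewrite /wint -[X in _ = fine X]mul1e -E1 -integral_ref_prod//.
    2: exact: b1.
  by under [in RHS]eq_integral do rewrite /= mul1r.
rewrite Ef Eg /wint integral_ref_prod// fineM//.
  exact: integrable_fin_num If.
exact: integrable_fin_num Ig.
Qed.

End reference_product.

Section kalman_gain.
Context {R : realType} (d K : nat).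
Variables (Sigma : 'M[R]_d) (Gamma : 'M[R]_K) (a : 'cV[R]_d) (b : 'cV[R]_K).
Hypotheses (PS : posdefmx Sigma) (PG : posdefmx Gamma).

Local Notation T := ('cV[R]_d * 'cV[R]_K)%type.
Local Notation lam := (leb R d \x leb R K)%E.
Local Notation ref := (ref Sigma Gamma a b).
Local Notation close := (close Sigma Gamma a b).

Lemma cov_density k l (q : T -> R) (X : T -> 'cV[R]_k) (Y : T -> 'cV[R]_l) i j :
  measurable_fun setT q -> (forall z, 0 <= q z) ->
  measurable_fun setT X -> measurable_fun setT Y ->
  cov (density_measure lam q) X Y i j =
  wint lam q (fun z => (X z i ord0 - wint lam q (fun t => X t i ord0)) *
                       (Y z j ord0 - wint lam q (fun t => Y t j ord0))).
Proof.
move=> mq q0 mX mY; rewrite mxE /wint.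
have mXi := measurable_fun_entry i ord0 mX.
have mYj := measurable_fun_entry j ord0 mY.
rewrite !integral_density//.
by apply: measurable_funM; exact: measurable_funB.
Qed.

(** On bounded boxes the reference density is bounded below, hence so is
    every density close to it. *)
Lemma close_box_lower : exists2 kap, 0 < kap & forall rho q (sd : 'I_d -> bool)
    (sk : 'I_K -> bool) z, rho <= kap -> close rho q ->
  unit_box sd z.1 -> unit_box sk z.2 -> kap <= q z.
Proof.
have gS0 := gauss_factor_gt0 PS; have gG0 := gauss_factor_gt0 PG.
set cA := fnorm2 (sqrtmx (invmx Sigma)); set cB := fnorm2 (sqrtmx (invmx Gamma)).
have cA0 : 0 <= cA by exact: fnorm2_ge0.
have cB0 : 0 <= cB by exact: fnorm2_ge0.
set S := cA * (8 * d%:R + 2 * nsq a) + cB * (8 * K%:R + 2 * nsq b).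
set k0 := gauss_factor Sigma * gauss_factor Gamma * expR (- 2^-1 * S).
have k00 : 0 < k0 by rewrite !mulr_gt0 ?expR_gt0.
exists (k0 / 2) => [|rho q sd sk z rk cq bu by_]; first by rewrite divr_gt0.
have Qle : quadU Sigma a z.1 + quadY Gamma b z.2 <= S.
  apply: lerD; apply: le_trans (nsq_mulmx_le _ _) _; rewrite ler_wpM2l//.
    by have := nsqB_le z.1 a; have := unit_box_nsq bu; lra.
  by have := nsqB_le z.2 b; have := unit_box_nsq by_; lra.
have rlow : k0 <= ref z.
  rewrite refE /k0 ler_wpM2l//; first by rewrite mulr_ge0// ltW.
  by rewrite ler_expR !mulNr lerN2 ler_wpM2l.
have w1 : 0 <= weight Sigma Gamma a b 4^-1 z <= 1.
  rewrite expR_ge0 -expR0 ler_expR mulNr oppr_le0 mulr_ge0//.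
  by rewrite addr_ge0 ?nsq_ge0.
have : rho * weight Sigma Gamma a b 4^-1 z <= k0 / 2.
  have [r0|r0] := leP 0 rho; first by case/andP: w1 => ? ?; nra.
  by case/andP: w1 => ? ?; nra.
by have := cq z; rewrite ler_distl => /andP[]; lra.
Qed.

(** The cross covariance is of order [rho], because the two variables are
    independent under the reference law, while the covariance of the observation
    stays bounded below. *)
Lemma gain_bound : exists C rho0 : R, [/\ 0 < C, 0 < rho0 &
  forall rho (q : T -> R), 0 <= rho <= rho0 -> measurable_fun setT q ->
    (forall z, 0 <= q z) -> (\int[lam]_z (q z)%:E = 1)%E -> close rho q ->
    let nu := density_measure lam q in
    forall w : 'cV[R]_K, nsq (cov nu fst snd *m invmx (cov nu snd snd) *m w) <=
                         (C * rho) ^+ 2 * nsq w].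
Proof.
have [C C0 HC] := moment_close a b PS PG.
have [kap kap0 Hkap] := close_box_lower.
set C3 := C + 3 * C ^+ 2.
have C30 : 0 < C3 by rewrite addr_gt0// mulr_gt0// exprn_gt0.
set D := (d * K)%:R + 1 : R.
have D0 : 0 <= (d * K)%:R :> R by exact: ler0n.
exists (C3 / kap * D), (Num.min 1 kap); split.
- by rewrite mulr_gt0 ?divr_gt0// ltr_wpDl.
- by rewrite lt_min ltr01.
move=> rho q /andP[rho0]; rewrite le_min => /andP[rho1 rhok] mq q0 q1 cq nu w.
pose J := wint lam q; pose E0 := wint lam ref.
pose U i (z : T) : R := z.1 i ord0; pose Y j (z : T) : R := z.2 j ord0.
have mU i : measurable_fun setT (U i).
  exact: measurable_fun_entry measurable_fst.
have mY j : measurable_fun setT (Y j).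
  exact: measurable_fun_entry measurable_snd.
have sq1 (x : R) : `|x| <= 1 + x ^+ 2.
  rewrite ler_norml; have := sqr_ge0 (x - 1); have := sqr_ge0 (x + 1) => ? ?.
  by apply/andP; split; nra.
have ent n (v : 'cV[R]_n) i : `|v i ord0| <= 1 + nsq v.
  by rewrite (le_trans (sq1 _))// lerD2l sqr_entry_le.
have gU (z : T) : 1 + nsq z.1 <= growth z.
  by rewrite /growth ler_peMr ?addr_ge0 ?nsq_ge0// lerDl nsq_ge0.
have gY (z : T) : 1 + nsq z.2 <= growth z.
  by rewrite /growth ler_peMl ?addr_ge0 ?nsq_ge0// lerDl nsq_ge0.
have H (f : T -> R) : measurable_fun setT f -> (forall z, `|f z| <= growth z) ->
   [/\ wintegrable lam q f, `|E0 f| <= C & `|J f - E0 f| <= C * rho].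
  move=> mf fb; have [|? ? ] := HC rho 1 q f rho0 ler01 mq cq mf.
    by move=> z; rewrite mul1r.
  by rewrite !mul1r.
have I1 : wintegrable lam q (cst 1).
  by have [//|z|//] := H (cst 1); rewrite /= normr1; exact: growth_ge1.
have J1 : J (cst 1) = 1.
  by rewrite /J /wint; under eq_integral do rewrite /= mul1r; rewrite q1.
have HU i := H _ (mU i) (fun z => le_trans (ent _ z.1 i) (gU z)).
have HY j := H _ (mY j) (fun z => le_trans (ent _ z.2 j) (gY z)).
have HUY i j : [/\ wintegrable lam q (fun z => U i z * Y j z),
    `|E0 (fun z => U i z * Y j z)| <= C &
    `|J (fun z => U i z * Y j z) - E0 (fun z => U i z * Y j z)| <= C * rho].
  apply: H; first exact: measurable_funM.
  by move=> z; rewrite normrM ler_pM// ent.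
have HYY i j : wintegrable lam q (fun z => Y i z * Y j z).
  have [|z|//] := H (fun z => Y i z * Y j z); first exact: measurable_funM.
  apply: le_trans (gY z); rewrite normrM.
  have := sqr_entry_le z.2 i; have := sqr_entry_le z.2 j.
  rewrite -(real_normK (num_real (z.2 i ord0))).
  rewrite -(real_normK (num_real (z.2 j ord0))).
  by rewrite /Y; have := sqr_ge0 (`|z.2 i ord0| - `|z.2 j ord0|); nra.
set Cuy := cov nu fst snd; set Cyy := cov nu snd snd.
have Cuyb i j : Cuy i j ^+ 2 <= (C3 * rho) ^+ 2.
  have [IU BU DU] := HU i; have [IY BY DY] := HY j; have [IUY _ DUY] := HUY i j.
  have [_ cE] := wint_cov I1 J1 IU IY IUY.
  have -> : Cuy i j = J (fun z => U i z * Y j z) - J (U i) * J (Y j).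
    by rewrite /Cuy cov_density.
  have EE : E0 (fun z => U i z * Y j z) = E0 (U i) * E0 (Y j).
    apply: (@wint_ref_prod R d K Sigma Gamma a b PS PG
      (fun u => u i ord0) (fun y => y j ord0)) => //; exact: measurable_coord.
  rewrite -(real_normK (num_real (_ - _))) lerXn2r ?nnegrE ?mulr_ge0 ?(ltW C30)//.
  move: DUY; rewrite EE => DUY.
  move: (J (fun z => _)) (J (U i)) (J (Y j)) (E0 (U i)) (E0 (Y j)) DU DY DUY BU BY.
  move=> juy ju jy eu ey DU DY DUY BU BY.
  have -> : juy - ju * jy =
    (juy - eu * ey) + (eu * (ey - jy) + (eu - ju) * jy) by ring.
  have jyb : `|jy| <= 2 * C.
    rewrite -(subrK ey jy) (le_trans (ler_normD _ _))//.
    have : C * rho <= C by rewrite ler_piMr// ltW.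
    by lra.
  apply: le_trans (ler_normD _ _) _; apply: le_trans (lerD DUY (ler_normD _ _)) _.
  rewrite !normrM (distrC ey) (distrC eu).
  have h1 := ler_pM (normr_ge0 _) (normr_ge0 _) BU DY.
  have h2 := ler_pM (normr_ge0 _) (normr_ge0 _) DU jyb.
  by rewrite /C3; nra.
have Fuy : fnorm2 Cuy <= (d * K)%:R * (C3 * rho) ^+ 2.
  rewrite /fnorm2 (le_trans (_ : _ <= \sum_(i < d) \sum_(j < K) (C3 * rho) ^+ 2))//.
    by apply: ler_sum => i _; apply: ler_sum => j _.
  by rewrite !sumr_const !card_ord -mulrnA mulr_natl mulnC.
(* The variance of a linear form [ell] of the observation is at least its
   integral over a box where both [ell ^+ 2] and [q] are bounded below. *)
have coer (v : 'cV[R]_K) : kap * nsq v <= (v^T *m Cyy *m v) ord0 ord0.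
  pose m j := J (Y j); pose phi j z := Y j z - m j.
  have Ip i j : wintegrable lam q (fun z => phi i z * phi j z).
    have [IYi _ _] := HY i; have [IYj _ _] := HY j.
    by have [] := wint_cov I1 J1 IYi IYj (HYY i j).
  have CE i j : Cyy i j = J (fun z => phi i z * phi j z) by rewrite /Cyy cov_density.
  pose t := \sum_i v i ord0 * m i.
  pose ell (z : T) := (\sum_i v i ord0 * z.2 i ord0 - t) ^+ 2 : R.
  have ellE z : ell z = \sum_i \sum_j (v i ord0 * v j ord0) * (phi i z * phi j z).
    rewrite /ell /t -sumrB expr2 mulr_suml; apply: eq_bigr => i _.
    by rewrite mulr_sumr; apply: eq_bigr => j _; rewrite /phi /Y; ring.
  have S1 i := wint_sum (fun j => (wintZ (v i ord0 * v j ord0) (Ip i j)).1).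
  have S2 := wint_sum (fun i => (S1 i).1).
  have elle : ell =
      (fun z => \sum_i \sum_j (v i ord0 * v j ord0) * (phi i z * phi j z)).
    exact/funext.
  have [Iell Eell] :
      wintegrable lam q ell /\ J ell = (v^T *m Cyy *m v) ord0 ord0.
    rewrite elle; split; first exact: S2.1.
    transitivity (\sum_i \sum_j v i ord0 * v j ord0 * Cyy i j).
      rewrite /J S2.2; apply: eq_bigr => i _; rewrite (S1 i).2.
      by apply: eq_bigr => j _; rewrite (wintZ _ (Ip i j)).2 CE.
    rewrite exchange_big mxE; apply: eq_bigr => j _.
    rewrite mxE mulr_suml; apply: eq_bigr => i _.
    by rewrite (_ : v^T ord0 i = v i ord0); [ring|rewrite mxE].
  rewrite -Eell -lee_fin /J /wint fineK; last exact: integrable_fin_num Iell.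
  have [sg Hsg] := unit_box_linear v t.
  pose bx : set T := unit_box (fun=> false) `*` unit_box sg.
  have mbx : measurable bx by apply: measurableX; exact: measurable_unit_box.
  have lbx : lam bx = 1%E.
    rewrite /bx product_measure1E; [|exact: measurable_unit_box|exact: measurable_unit_box].
    by rewrite leb_unit_box mule1; exact: leb_unit_box.
  have ell0 z : 0 <= ell z * q z by rewrite mulr_ge0 ?sqr_ge0.
  have mell : measurable_fun setT (fun z => (ell z * q z)%:E).
    exact: measurable_int Iell.
  apply: (@le_trans _ _ (\int[lam]_(z in bx) (ell z * q z)%:E)%E).
    rewrite -[leLHS]mule1 -lbx -integral_cst//.
    apply: ge0_le_integral => //.
    - by move=> z _; rewrite lee_fin mulr_ge0 ?nsq_ge0// ltW.
    - exact: measurable_funTS.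
    - move=> z [bu by_]; rewrite lee_fin mulrC.
      apply: ler_pM; [exact: nsq_ge0|exact: ltW|exact: Hsg|].
      exact: Hkap cq bu by_.
  by apply: ge0_subset_integral => // z _; rewrite lee_fin.
have Cu : Cyy \in unitmx.
  apply: posdef_unit => v v0; apply: lt_le_trans (coer v).
  by rewrite mulr_gt0// nsq_gt0.
(* If [x] is the image of [w] by the inverse, coercivity gives
   [kap * nsq x <= x^T w], to which Cauchy-Schwarz applies. *)
have invb : nsq (invmx Cyy *m w) <= kap ^- 2 * nsq w.
  set x := invmx Cyy *m w.
  have := coer x; rewrite -mulmxA mulKVmx// => h1.
  have h2 : (x^T *m w) ord0 ord0 ^+ 2 <= nsq x * nsq w.
    rewrite mxE; under eq_bigr do rewrite mxE.
    exact: cauchy_schwarz_sum.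
  have x0 := nsq_ge0 x; have w0 := nsq_ge0 w.
  rewrite mulrC ler_pdivlMr ?exprn_gt0//.
  move: x0; rewrite le_eqVlt => /predU1P[<-|x0]; first by rewrite mul0r.
  rewrite -(ler_pM2l x0); apply: le_trans h2.
  rewrite [leLHS](_ : _ = (kap * nsq x) ^+ 2); last by ring.
  have p0 : 0 <= kap * nsq x by rewrite mulr_ge0// ltW.
  by rewrite lerXn2r// nnegrE (le_trans p0).
rewrite -mulmxA; apply: le_trans (nsq_mulmx_le _ _) _.
apply: le_trans (ler_pM (fnorm2_ge0 _) (nsq_ge0 _) Fuy invb) _.
rewrite [leLHS](_ : _ = (C3 / kap * rho) ^+ 2 * nsq w * (d * K)%:R); last first.
  by field; rewrite gt_eqF.
rewrite [leRHS](_ : _ = (C3 / kap * rho) ^+ 2 * nsq w * D ^+ 2); last first.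
  by field; rewrite gt_eqF.
rewrite ler_wpM2l//; last by rewrite /D; nra.
by apply: mulr_ge0; [exact: sqr_ge0|exact: nsq_ge0].
Qed.

End kalman_gain.

(** * One step of each filter *)

Section last_step.
Context {R : realType} (d K : nat).
Variables (Sigma : 'M[R]_d) (Gamma : 'M[R]_K) (a : 'cV[R]_d) (b : 'cV[R]_K).
Hypotheses (PS : posdefmx Sigma) (PG : posdefmx Gamma).
Variable kY : R.

Local Notation T := ('cV[R]_d * 'cV[R]_K)%type.
Local Notation lam := (leb R d \x leb R K)%E.
Local Notation ref := (ref Sigma Gamma a b).
Local Notation close := (close Sigma Gamma a b).

Definition near_constant r (Psi : 'cV[R]_d -> 'cV[R]_d) (h : 'cV[R]_d -> 'cV[R]_K) :=
  [/\ measurable_fun setT Psi, measurable_fun setT h,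
      forall u, nsq (Psi u - a) <= r ^+ 2 & forall u, nsq (h u - b) <= r ^+ 2].

(** The distance to N(a, Sigma) in the weighted total variation metric, together
    with the fact that a step does not lose mass. *)
Definition step_close C r (nu : set 'cV[R]_d -> \bar R) :=
  (exists P : probability 'cV[R]_d R, nu = P) /\
  forall f : 'cV[R]_d -> R, measurable_fun setT f ->
    (forall u, `|f u| <= 1 + nsq u) ->
    (`|\int[nu]_u (f u)%:E - \int[leb R d]_u (f u * refU Sigma a u)%:E|
      <= (C * r)%:E)%E.

Lemma QP_close0 : exists C r0 : R, [/\ 0 < C, 0 < r0 &
  forall (mu : probability 'cV[R]_d R) Psi h r, 0 <= r <= r0 ->
    near_constant r Psi h -> close (C * r) (QP_density Sigma Gamma Psi h mu)].
Proof.
have [C [r0 [C0 r00 HC]]] := QP_close a b PS PG.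
exists C, r0; split=> // mu Psi h r r01 [mPsi mh HPsi Hh] z.
have := HC mu Psi h (cst 0) r r01 mPsi HPsi Hh _ z; rewrite /= subr0 -surjective_pairing.
by apply=> y; rewrite /= nsq0 mulr_ge0 ?sqr_ge0 ?addr_ge0 ?nsq_ge0.
Qed.

(** Conditioning on [y] divides by a normalization which stays away from 0. *)
Lemma true_step_close : exists C r0 : R, [/\ 0 < C, 0 < r0 &
  forall (mu : probability 'cV[R]_d R) Psi h y r, 0 <= r <= r0 ->
    near_constant r Psi h -> nsq y <= kY ->
    step_close C r (true_step Sigma Gamma Psi h mu y)].
Proof.
have [C1 [r1 [C10 r10 HC]]] := QP_close0.
have [M M0 HM] := growthU a PS.
have gS0 := gauss_factor_gt0 PS; have gG0 := gauss_factor_gt0 PG.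
set cB := fnorm2 (sqrtmx (invmx Gamma)).
have cB0 : 0 <= cB by exact: fnorm2_ge0.
set ga0 := gauss_factor Gamma * expR (- 2^-1 * (cB * (2 * kY + 2 * nsq b))).
have ga00 : 0 < ga0 by rewrite mulr_gt0 ?expR_gt0.
have mquad := measurable_quadU Sigma a.
pose e c u := expR (- c * quadU Sigma a u).
have me c : measurable_fun setT (e c).
  by apply: measurableT_comp => //; exact: measurable_funM.
have e0 c u : 0 <= e c u by exact: expR_ge0.
pose Z c := fine (\int[leb R d]_u (e c u)%:E)%E.
have ZE c : 0 < c -> ((Z c)%:E = \int[leb R d]_u (e c u)%:E)%E.
  move=> c0; rewrite /Z fineK// ge0_fin_numE; first exact: integral_weightU_lty.
  by apply: integral_ge0 => u _; rewrite lee_fin.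
have Z0 c : 0 <= Z c by apply: fine_ge0; apply: integral_ge0 => u _; rewrite lee_fin.
have kZ k c : 0 <= k -> 0 < c ->
    (\int[leb R d]_u (k * e c u)%:E <= (k * Z c)%:E)%E.
  move=> k0 c0; under eq_integral do rewrite EFinM.
  rewrite ge0_integralZl//=; first by rewrite -ZE// -EFinM.
    by apply/measurable_EFinP; exact: me.
  by move=> u _; rewrite lee_fin.
have i4 : 0 < 4^-1 :> R by rewrite invr_gt0.
have i8 : 0 < 8^-1 :> R by rewrite invr_gt0.
set C2 := 2 / ga0 * C1 * (1 + gauss_factor Sigma * Z 4^-1).
have C20 : 0 < C2.
  have p1 : 0 < 1 + gauss_factor Sigma * Z 4^-1.
    by rewrite ltr_pwDl// mulr_ge0// ltW.
  by rewrite /C2 !mulr_gt0 ?invr_gt0.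
(* The second bound on [r] keeps the normalization above [ga0 / 2]. *)
exists (C2 * M * (Z 8^-1 + 1)), (Num.min r1 (ga0 / (2 * C1 * (Z 4^-1 + 1)))).
split.
- by apply: mulr_gt0; [exact: mulr_gt0|rewrite ltr_wpDl].
- have p1 : 0 < Z 4^-1 + 1 by rewrite ltr_wpDl.
  by rewrite lt_min r10 divr_gt0//; apply: mulr_gt0 => //; exact: mulr_gt0.
move=> mu Psi h y r /andP[r0]; rewrite le_min => /andP[rr1 rga] nc yk.
have [mPsi mh HPsi Hh] := nc.
pose q := QP_density Sigma Gamma Psi h mu.
have mq : measurable_fun setT q by exact: measurable_QP.
have q0 z : 0 <= q z by exact: QP_ge0.
have cq : close (C1 * r) q by apply: HC => //; apply/andP.
pose qy u := q (u, y).
have mqy : measurable_fun setT qy.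
  by apply: measurableT_comp mq _; exact: measurable_fun_pair.
pose ga := refY Gamma b y.
have gage : ga0 <= ga.
  rewrite /ga /refY /ga0 ler_wpM2l ?(ltW gG0)// ler_expR !mulNr lerN2 ler_wpM2l//.
  apply: le_trans (nsq_mulmx_le _ _) _; rewrite ler_wpM2l//.
  by have := nsqB_le y b; lra.
have cqy u : `|qy u - refU Sigma a u * ga| <= C1 * r * e 4^-1 u.
  apply: le_trans (cq (u, y)) _; rewrite ler_wpM2l ?mulr_ge0 ?(ltW C10)//.
  rewrite /weight /e ler_expR /=; have := quadY_ge0 Gamma b y.
  by have := quadU_ge0 Sigma a u; nra.
have Iref : (leb R d).-integrable setT (EFin \o refU Sigma a).
  have := @wintegrable_refU R d Sigma a (cst 1) PS (measurable_cst _) _.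
  rewrite /wintegrable; under eq_fun do rewrite mul1r.
  by apply=> u; rewrite /= normr1 lerDl nsq_ge0.
have Iref2 : (leb R d).-integrable setT (EFin \o (fun u => refU Sigma a u * ga)).
  rewrite (_ : EFin \o _ = (cst ga%:E \* (EFin \o refU Sigma a))%E).
    exact: integrableZl.
  by apply/funext => u /=; rewrite -EFinM mulrC.
have c1r : 0 <= C1 * r by rewrite mulr_ge0// ltW.
have mk k c : measurable_fun setT (fun u => k * e c u).
  by apply: measurable_funM => //; exact: me.
have [Iq Dg _] := integral_dist mqy Iref2 (mk _ _) (kZ _ _ c1r i4) cqy.
set D := fine (\int[leb R d]_u (qy u)%:E)%E in Dg.
have gaE : fine (\int[leb R d]_u (refU Sigma a u * ga)%:E)%E = ga.
  under eq_integral do rewrite EFinM.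
  by rewrite integralZr// integral_refU// mul1e.
rewrite gaE in Dg.
have small : C1 * r * Z 4^-1 <= ga0 / 2.
  move: rga; rewrite ler_pdivlMr; last by rewrite !mulr_gt0// ltr_wpDl.
  by have := mulr_ge0 c1r (Z0 4^-1); nra.
have Dge : ga0 / 2 <= D by move: Dg; rewrite ler_distl => /andP[]; lra.
have D0 : 0 < D by rewrite (lt_le_trans _ Dge)// divr_gt0.
pose p := B_density y q.
have pE u : p u = qy u / D by [].
have mp : measurable_fun setT p.
  by apply: measurable_funM => //.
have p0 u : 0 <= p u by rewrite pE divr_ge0 ?(ltW D0)//; exact: q0.
have p1 : (\int[leb R d]_u (p u)%:E = 1)%E.
  under eq_integral do rewrite pE EFinM.
  rewrite integralZr// -[X in (X * _)%E](fineK (integrable_fin_num _ Iq))// -EFinM.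
  by rewrite -/D divff// gt_eqF.
split=> [|f mf fb]; first exact: (density_probability mp p0 p1).
rewrite /true_step -/p integral_density//.
have cp u : `|p u - refU Sigma a u| <= C2 * r * e 4^-1 u.
  rewrite pE (_ : _ - _ = ((qy u - refU Sigma a u * ga) +
    refU Sigma a u * (ga - D)) / D); last by field; rewrite gt_eqF.
  rewrite normrM normfV (gtr0_norm D0) ler_pdivrMr//.
  apply: le_trans (ler_normD _ _) _; apply: le_trans (lerD (cqy u) (lexx _)) _.
  have rU := refU_gt0 a PS u.
  rewrite normrM (gtr0_norm rU) distrC.
  have rUe : refU Sigma a u <= gauss_factor Sigma * e 4^-1 u.
    rewrite ler_wpM2l ?(ltW gS0)// ler_expR ler_wpM2r ?quadU_ge0//.
    by lra.
  apply: le_trans (lerD (lexx _) (ler_pM (ltW rU) (normr_ge0 _) rUe Dg)) _.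
  apply: (@le_trans _ _ (C2 * r * e 4^-1 u * (ga0 / 2))); last first.
    apply: ler_wpM2l => //.
    by apply: mulr_ge0 => //; apply: mulr_ge0 => //; exact: ltW.
  rewrite /C2 le_eqVlt; apply/orP; left; apply/eqP; field; rewrite gt_eqF//.
have Ifr := wintegrable_refU a PS mf fb.
have mfp : measurable_fun setT (fun u => f u * p u) by exact: measurable_funM.
have cf : 0 <= C2 * r * M.
  by apply: mulr_ge0; [apply: mulr_ge0 => //; exact: ltW|exact: ltW].
have cfp u : `|f u * p u - f u * refU Sigma a u| <= C2 * r * M * e 8^-1 u.
  rewrite -mulrBr normrM.
  apply: le_trans (ler_pM (normr_ge0 _) (normr_ge0 _)
    (le_trans (fb u) (HM u)) (cp u)) _.
  rewrite [leLHS](_ : _ = C2 * r * M *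
    (expR (8^-1 * quadU Sigma a u) * e 4^-1 u)); last by ring.
  rewrite ler_wpM2l// /e -expRD ler_expR.
  by have := quadU_ge0 Sigma a u; lra.
have [_ _ H] := integral_dist mfp Ifr (mk _ _) (kZ _ _ cf i8) cfp.
apply: le_trans H _.
rewrite lee_fin [leRHS](_ : _ = C2 * r * M * (Z 8^-1 + 1)); last by ring.
by rewrite ler_wpM2l// lerDl.
Qed.

Lemma integral_shear (s : 'cV[R]_K -> 'cV[R]_d) (F : T -> \bar R) :
  measurable_fun setT s -> measurable_fun setT F -> (forall z, 0 <= F z)%E ->
  (\int[lam]_z F (z.1 + s z.2, z.2)%R = \int[lam]_z F z)%E.
Proof.
move=> ms mF F0.
have msh : measurable_fun setT (fun z : T => F (z.1 + s z.2, z.2)).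
  apply: measurableT_comp mF _; apply: measurable_fun_pair.
    2: exact: measurable_snd.
  apply: measurable_mxD; first exact: measurable_fst.
  exact: measurableT_comp ms measurable_snd.
rewrite (fubini_tonelli2 _ msh (fun z => F0 _)) (fubini_tonelli2 _ mF F0).
apply: eq_integral => y _; rewrite /fubini_G /=.
apply: (leb_integral_shift (s y) (f := fun u => F (u, y))) => //.
by apply: measurableT_comp mF _; exact: measurable_fun_pair.
Qed.

(** A translation of the first variable turns the Kalman update into a change of
    density, to which the perturbation estimate applies again. *)
Lemma kalman_step_close : exists C r0 : R, [/\ 0 < C, 0 < r0 &
  forall (mu : probability 'cV[R]_d R) Psi h y r, 0 <= r <= r0 ->
    near_constant r Psi h -> nsq y <= kY ->
    step_close C r (kalman_step Sigma Gamma Psi h mu y)].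
Proof.
have [C1 [r1 [C10 r10 HC]]] := QP_close0.
have [C1' [r1' [C10' r10' HC']]] := QP_close a b PS PG.
have [C2 [rho0 [C20 rho00 HG]]] := gain_bound a b PS PG.
have [C4 C40 HC4] := moment_close a b PS PG.
set cY := 4 * `|kY| + 4 * nsq b + 2.
have cY0 : 0 <= cY by have := normr_ge0 kY; have := nsq_ge0 b; rewrite /cY; lra.
set C3 := C2 * C1 * (1 + cY) + 1.
have C21 : 0 < C2 * C1 by rewrite mulr_gt0.
have C31 : 1 <= C3 by rewrite lerDr mulr_ge0 ?(ltW C21)// addr_ge0.
have C30 : 0 < C3 by lra.
exists (C4 * (C1' * C3)), (Num.min r1 (Num.min (rho0 / C1) (r1' / C3))); split.
- by rewrite !mulr_gt0.
- by rewrite !lt_min r10 !divr_gt0.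
move=> mu Psi h y r /andP[r0]; rewrite !le_min => /and3P[rr1 rrho rr1'] nc yk.
have [mPsi mh HPsi Hh] := nc.
pose q := QP_density Sigma Gamma Psi h mu.
have mq : measurable_fun setT q by exact: measurable_QP.
have q0 z : 0 <= q z by exact: QP_ge0.
have q1 : (\int[lam]_z (q z)%:E = 1)%E by exact: integral_QP.
have cq : close (C1 * r) q by apply: HC => //; apply/andP.
have [nu nuE] := density_probability mq q0 q1.
have c1r : 0 <= C1 * r <= rho0.
  by rewrite mulr_ge0 ?(ltW C10)//= mulrC -ler_pdivlMr.
have HL := HG (C1 * r) q c1r mq q0 q1 cq.
pose L := cov (density_measure lam q) fst snd *m
  invmx (cov (density_measure lam q) snd snd).
rewrite /= -/L in HL.
pose s (y' : 'cV[R]_K) := L *m (y - y').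
have ms : measurable_fun setT s by apply: measurable_mxM; exact: measurable_mxB.
have sb y' : nsq (s y') <= (C3 * r) ^+ 2 * (1 + nsq (y' - b)).
  apply: (le_trans (HL _)).
  have h1 : nsq (y - y') <= (1 + cY) ^+ 2 * (1 + nsq (y' - b)).
    have h2 := nsqB_le (y - b) (y' - b); have h3 := nsqB_le y b.
    have <- : y - b - (y' - b) = y - y' by apply/colP => i; rewrite !mxE; ring.
    apply: (le_trans h2); have h4 := ler_norm kY; have h5 := nsq_ge0 (y' - b).
    apply: (@le_trans _ _ (cY * (1 + nsq (y' - b)))).
      have : 0 <= (cY - 2) * nsq (y' - b).
        by rewrite mulr_ge0// /cY; have := normr_ge0 kY; have := nsq_ge0 b; lra.
      by rewrite /cY; nra.
    by rewrite ler_wpM2r ?addr_ge0//; nra.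
  have h6 := ler_wpM2l (sqr_ge0 (C2 * (C1 * r))) h1.
  apply: (le_trans h6); rewrite [leLHS]mulrA -exprMn ler_wpM2r ?addr_ge0 ?nsq_ge0//.
  have p1 : 0 <= C2 * (C1 * r) * (1 + cY).
    by rewrite !mulr_ge0 ?(ltW C20) ?(ltW C10)// addr_ge0.
  have p2 : 0 <= C3 * r by apply: mulr_ge0 => //; exact: ltW.
  rewrite lerXn2r ?nnegrE// /C3 [leRHS]mulrDl mul1r.
  by rewrite [leLHS](_ : _ = C2 * C1 * (1 + cY) * r) ?lerDl//; ring.
have c3r : 0 <= C3 * r <= r1'.
  by rewrite mulr_ge0 ?(ltW C30)//= mulrC -ler_pdivlMr.
have rC3 : r ^+ 2 <= (C3 * r) ^+ 2.
  by rewrite lerXn2r ?nnegrE ?mulr_ge0 ?(ltW C30)// ler_peMl.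
pose qT (z : T) := q (z.1 - s z.2, z.2).
have cqT : close (C1' * (C3 * r)) qT.
  by apply: HC' => // u; [exact: le_trans (HPsi u) rC3|exact: le_trans (Hh u) rC3].
have mqT : measurable_fun setT qT.
  apply: measurableT_comp mq _; apply: measurable_fun_pair.
    2: exact: measurable_snd.
  apply: measurable_mxB; first exact: measurable_fst.
  exact: measurableT_comp ms measurable_snd.
pose Tm (z : T) : 'cV[R]_d := z.1 + s z.2.
have mTm : measurable_fun setT Tm.
  apply: measurable_mxD; first exact: measurable_fst.
  exact: measurableT_comp ms measurable_snd.
pose Tf : {mfun T >-> 'cV[R]_d} :=
  HB.pack Tm (isMeasurableFun.Build _ _ _ _ _ mTm).
have kE : kalman_step Sigma Gamma Psi h mu y = distribution nu Tf.
  by rewrite /kalman_step /T_measure -/q -/L nuE.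
split=> [|f mf fb]; first by exists (distribution nu Tf).
have ge0T (g : 'cV[R]_d -> \bar R) :
    measurable_fun setT g -> (forall x, 0 <= g x)%E ->
    (\int[distribution nu Tf]_x g x = \int[lam]_z (g z.1 * (qT z)%:E))%E.
  move=> mg g0; rewrite [LHS](ge0_integral_pushforward mTm)//.
  have mgT : measurable_fun setT (fun z => g (Tm z)).
    exact: measurableT_comp mg mTm.
  transitivity (\int[density_measure lam q]_z g (Tm z))%E.
    by rewrite preimage_setT nuE.
  rewrite [LHS](ge0_integral_density _ mq q0 mgT (fun z => g0 (Tm z))).
  rewrite -[RHS](integral_shear ms).
  - by apply: eq_integral => z _; rewrite /qT /= addrK -surjective_pairing.
  - apply: emeasurable_funM; last exact/measurable_EFinP.
    exact: measurableT_comp mg measurable_fst.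
  - by move=> z; rewrite mule_ge0 ?lee_fin ?q0.
have qT0 z : 0 <= qT z by exact: q0.
rewrite kE (signed_integral_transfer qT0 ge0T mf).
have mf1 : measurable_fun setT (fun z : T => f z.1).
  exact: measurableT_comp mf measurable_fst.
have ref1 : (\int[leb R d]_u (f u * refU Sigma a u)%:E =
    \int[lam]_z (f z.1 * ref z)%:E)%E.
  rewrite -[LHS]mule1 -(integral_refY b PG).
  under [X in (_ * X)%E]eq_integral do rewrite -[refY _ _ _]mul1r.
  have b1 (u : 'cV[R]_K) : `|cst 1 u : R| <= 1 + nsq u.
    by rewrite /= normr1 lerDl nsq_ge0.
  rewrite -(integral_ref_prod a b PS PG mf (measurable_cst (1 : R)) fb b1).
  by apply: eq_integral => z _; rewrite /= mulr1.
rewrite ref1.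
have c0 : 0 <= C1' * (C3 * r) by rewrite !mulr_ge0// ltW.
have [|_ _ _ _ H] := HC4 _ 1 _ _ c0 ler01 mqT cqT mf1.
  move=> z; rewrite mul1r (le_trans (fb _))//.
  by rewrite /growth ler_peMr ?addr_ge0 ?nsq_ge0// lerDl nsq_ge0.
by apply: le_trans H _; rewrite lee_fin mul1r !mulrA.
Qed.

(** Both filters are close to the law that they have for constant dynamics, which
    does not depend on the incoming laws [mu1] and [mu2]. *)
Lemma step_dg : exists C r0 : R, [/\ 0 < C, 0 < r0 &
  forall Psi h r, 0 <= r <= r0 -> near_constant r Psi h ->
  forall y, nsq y <= kY -> forall mu1 mu2 : probability 'cV[R]_d R,
  [/\ exists P : probability 'cV[R]_d R, kalman_step Sigma Gamma Psi h mu1 y = P,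
      exists P : probability 'cV[R]_d R, true_step Sigma Gamma Psi h mu2 y = P &
      (dg (kalman_step Sigma Gamma Psi h mu1 y)
          (true_step Sigma Gamma Psi h mu2 y) <= (C * r)%:E)%E]].
Proof.
have [C1 [r1 [C10 r10 H1]]] := kalman_step_close.
have [C2 [r2 [C20 r20 H2]]] := true_step_close.
exists (C1 + C2), (Num.min r1 r2); split; [exact: addr_gt0|by rewrite lt_min r10|].
move=> Psi h r /andP[r0]; rewrite le_min => /andP[rr1 rr2] nc y yk mu1 mu2.
have [P1 B1] := H1 mu1 Psi h y r (introT andP (conj r0 rr1)) nc yk.
have [P2 B2] := H2 mu2 Psi h y r (introT andP (conj r0 rr2)) nc yk.
split=> //; apply: ge_ereal_sup => _ [f [mf fb] <-].
have fb' u : `|f u| <= 1 + nsq u by rewrite -enorm_sqr.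
have := B1 f mf fb'; have := B2 f mf fb'.
have Ifin := integrable_fin_num measurableT (wintegrable_refU a PS mf fb').
set I := (\int[leb R d]_u _)%E in Ifin *; move: Ifin.
set i1 := (\int[kalman_step _ _ _ _ _ _]_u _)%E.
set i2 := (\int[true_step _ _ _ _ _ _]_u _)%E.
case: I i1 i2 => [x| |]// [y1| |]// [y2| |]// _.
rewrite -!EFinB /= !lee_fin => b2 b1.
rewrite (_ : y1 - y2 = (y1 - x) - (y2 - x)); last by ring.
by rewrite (le_trans (ler_normB _ _))// mulrDl lerD.
Qed.

End last_step.

(** * The filters *)

Lemma continuous_measurable_mx (R : realType) m n p q
    (f : 'M[R]_(m, n) -> 'M[R]_(p, q)) :
  continuous f -> measurable_fun setT f.
Proof.
move=> cf; apply: (measurability (open : set (set 'M[R]_(p, q))) erefl).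
move=> _ [U oU <-].
by rewrite setTI; apply: open_measurable_mx; exact: open_comp.
Qed.

Lemma foldl_probability (R : realType) d (T : measurableType d) (A : eqType)
    (step : (set T -> \bar R) -> A -> set T -> \bar R) (s : seq A)
    (mu0 : probability T R) :
  (forall y, y \in s -> forall mu : probability T R,
    exists P : probability T R, step mu y = P) ->
  exists P : probability T R, foldl step mu0 s = P.
Proof.
elim: s mu0 => [|y s IH] mu0 H; first by exists mu0.
have [P PE] := H y (mem_head _ _) mu0; rewrite /= PE.
by apply: IH => y' ys; apply: H; rewrite inE ys orbT.
Qed.

Theorem corollary7 (R : realType) (d K J : nat)
    (kappa_y kappa_Psi kappa_h ell_h : R)
    (Sigma : 'M[R]_d) (Gamma : 'M[R]_K)
    (mu0 : probability 'cV[R]_d R)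
    (Psi0 : 'cV[R]_d -> 'cV[R]_d) (h0 : 'cV[R]_d -> 'cV[R]_K) :
  (1 <= d)%N -> (1 <= K)%N -> (1 <= J)%N ->
  0 < kappa_y -> 0 < kappa_Psi -> 0 < kappa_h -> 0 <= ell_h ->
  posdefmx Sigma -> posdefmx Gamma ->
  is_gaussian mu0 ->
  (exists a, forall u, Psi0 u = a) -> (exists b, forall u, h0 u = b) ->
  forall eps : R, 0 < eps ->
  exists2 delta : R, 0 < delta &
    (ereal_sup
      [set ereal_sup
        [set dg (kalman_filter Sigma Gamma Psih.1 Psih.2 mu0 Y)
                (true_filter Sigma Gamma Psih.1 Psih.2 mu0 Y)
        | Psih in model_ball kappa_Psi kappa_h ell_h Psi0 h0 delta]
      | Y in data_ball K J kappa_y] <= eps%:E)%E.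
Proof.
move=> _ _ J1 _ _ _ _ PS PG _ [a Psi0a] [b h0b] eps eps0.
have [C [r0 [C0 r00 H]]] := step_dg a b PS PG (kappa_y ^+ 2).
exists (Num.min r0 (eps / C)); first by rewrite lt_min r00 divr_gt0.
set delta := Num.min _ _.
have dr0 : 0 <= delta <= r0.
  by rewrite le_min ge_min lexx (ltW r00) divr_ge0 ?(ltW eps0) ?(ltW C0).
have dC : C * delta <= eps.
  by rewrite mulrC -ler_pdivlMr// ge_min lexx orbT.
apply: ge_ereal_sup => _ [Y HY <-]; apply: ge_ereal_sup => _ [[Psi h] [/=
  [mPsi _ cPsi] [ch _ chh _]] <-].
have nc : near_constant a b delta Psi h.
  split=> //; first exact: continuous_measurable_mx.
  - by move=> u; rewrite -(Psi0a u); exact: enorm_le_nsq.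
  - by move=> u; rewrite -(h0b u); exact: enorm_le_nsq.
have {}H := H Psi h delta dr0 nc.
have Yb y : y \in tval Y -> nsq y <= kappa_y ^+ 2.
  by move=> /tnthP[j ->]; apply: enorm_le_nsq; exact: HY.
have : size Y = J by exact: size_tuple.
rewrite /kalman_filter /true_filter; case: (lastP (tval Y)) Yb => [|s y] Yb sJ.
  by rewrite -sJ in J1.
rewrite !foldl_rcons.
have ys : y \in rcons s y by rewrite mem_rcons mem_head.
have ss y' : y' \in s -> y' \in rcons s y by rewrite mem_rcons inE => ->; rewrite orbT.
have [P1 ->] := foldl_probability (step := kalman_step Sigma Gamma Psi h) mu0
  (fun y' y's mu => let: And3 E _ _ := H y' (Yb _ (ss _ y's)) mu mu in E).
have [P2 ->] := foldl_probability (step := true_step Sigma Gamma Psi h) mu0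
  (fun y' y's mu => let: And3 _ E _ := H y' (Yb _ (ss _ y's)) mu mu in E).
have [_ _ E] := H y (Yb y ys) P1 P2.
by apply: le_trans E _; rewrite lee_fin.
Qed.
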